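(* There is a set-sized two-player game of perfect information (moves are sets drawn from a fixed set, plays of length $\omega$) whose winning condition is $\Delta_2$-definable in the L\'evy hierarchy of the first-order language of set theory, such that {\rm ZF} proves that neither player has a winning strategy in this game.
   Context: $\Delta_2$ here (written $\Delta^0_2$ in the paper) refers to the L\'evy hierarchy of first-order set-theoretic formulas: the winning condition is definable both by a $\Sigma_2$ and by a $\Pi_2$ formula of set theory; it does not refer to the arithmetic or projective hierarchies. *)

(* Defs.v *)
From Stdlib Require List.
From mathcomp Require Import all_boot.

Set Implicit Arguments.
Unset Strict Implicit.
Unset Printing Implicit Defensive.

(** * The first-order language of set theory

    The only terms are variables, and variables are de Bruijn indices.  Every
    formula-building function below takes the indices of its arguments in the
    ambient context, so an argument [x] is written [x.+k] under [k] binders. *)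

Inductive form : Type :=
| fBot
| fMem of nat & nat
| fEq of nat & nat
| fImp of form & form
| fAnd of form & form
| fOr of form & form
| fAll of form
| fEx of form.

Definition fNot phi := fImp phi fBot.
Definition fIff phi psi := fAnd (fImp phi psi) (fImp psi phi).

Declare Scope form_scope.
Delimit Scope form_scope with fm.
Bind Scope form_scope with form.
Notation "⊥" := fBot : form_scope.
Notation "x ∈ y" := (fMem x y) (at level 30, no associativity) : form_scope.
Notation "x ≐ y" := (fEq x y) (at level 30, no associativity) : form_scope.
Notation "¬ φ" := (fNot φ) (at level 35, right associativity) : form_scope.
Notation "∀ φ" := (fAll φ) (at level 35, right associativity) : form_scope.
Notation "∃ φ" := (fEx φ) (at level 35, right associativity) : form_scope.
Notation "φ ∧ ψ" := (fAnd φ ψ) (at level 61, right associativity) : form_scope.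
Notation "φ ∨ ψ" := (fOr φ ψ) (at level 62, right associativity) : form_scope.
Notation "φ → ψ" := (fImp φ ψ) (at level 63, right associativity) : form_scope.
Notation "φ ↔ ψ" := (fIff φ ψ) (at level 64, no associativity) : form_scope.
Local Open Scope form_scope.

Definition up (r : nat -> nat) (i : nat) : nat :=
  if i is j.+1 then (r j).+1 else 0.

Fixpoint ren (r : nat -> nat) (phi : form) : form :=
  match phi with
  | fBot => ⊥
  | fMem x y => r x ∈ r y
  | fEq x y => r x ≐ r y
  | fImp p q => ren r p → ren r q
  | fAnd p q => ren r p ∧ ren r q
  | fOr p q => ren r p ∨ ren r q
  | fAll p => ∀ (ren (up r) p)
  | fEx p => ∃ (ren (up r) p)
  end.

Definition shift (phi : form) : form := ren succn phi.

(** [inst x phi] is the body [phi] of a quantifier with the bound variable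
    replaced by [x]. *)
Definition inst (x : nat) (phi : form) : form :=
  ren (fun i => if i is j.+1 then j else x) phi.

(** All free variables are [< n]. *)
Fixpoint free_below (n : nat) (phi : form) : bool :=
  match phi with
  | fBot => true
  | fMem x y | fEq x y => (x < n) && (y < n)
  | fImp p q | fAnd p q | fOr p q => free_below n p && free_below n q
  | fAll p | fEx p => free_below n.+1 p
  end.

(** * Classical natural deduction with equality *)

Inductive prv : seq form -> form -> Prop :=
| prv_ax G p : List.In p G -> prv G p
| prv_raa G p : prv ((¬ p) :: G) ⊥ -> prv G p
| prv_impI G p q : prv (p :: G) q -> prv G (p → q)
| prv_impE G p q : prv G (p → q) -> prv G p -> prv G q
| prv_andI G p q : prv G p -> prv G q -> prv G (p ∧ q)
| prv_andE1 G p q : prv G (p ∧ q) -> prv G p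
| prv_andE2 G p q : prv G (p ∧ q) -> prv G q
| prv_orI1 G p q : prv G p -> prv G (p ∨ q)
| prv_orI2 G p q : prv G q -> prv G (p ∨ q)
| prv_orE G p q r :
    prv G (p ∨ q) -> prv (p :: G) r -> prv (q :: G) r -> prv G r
| prv_allI G p : prv (map shift G) p -> prv G (∀ p)
| prv_allE G p x : prv G (∀ p) -> prv G (inst x p)
| prv_exI G p x : prv G (inst x p) -> prv G (∃ p)
| prv_exE G p q :
    prv G (∃ p) -> prv (p :: map shift G) (shift q) -> prv G q
| prv_eqI G x : prv G (x ≐ x)
| prv_eqE G p x y : prv G (x ≐ y) -> prv G (inst x p) -> prv G (inst y p).

Definition proves (T : form -> Prop) (phi : form) : Prop :=
  exists2 G : seq form, (forall psi, List.In psi G -> T psi) & prv G phi.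

(** * The Lévy hierarchy *)

Inductive Delta0 : form -> Prop :=
| Delta0_bot : Delta0 ⊥
| Delta0_mem x y : Delta0 (x ∈ y)
| Delta0_eq x y : Delta0 (x ≐ y)
| Delta0_imp p q : Delta0 p -> Delta0 q -> Delta0 (p → q)
| Delta0_and p q : Delta0 p -> Delta0 q -> Delta0 (p ∧ q)
| Delta0_or p q : Delta0 p -> Delta0 q -> Delta0 (p ∨ q)
| Delta0_ball y p : Delta0 p -> Delta0 (∀ (0 ∈ y.+1 → p))
| Delta0_bex y p : Delta0 p -> Delta0 (∃ (0 ∈ y.+1 ∧ p)).

(** Blocks of like quantifiers are allowed, possibly empty. *)
Inductive Sigma : nat -> form -> Prop :=
| Sigma_Delta0 p : Delta0 p -> Sigma 0 p
| Sigma_Pi n p : Pi n p -> Sigma n.+1 p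
| Sigma_ex n p : Sigma n.+1 p -> Sigma n.+1 (∃ p)
with Pi : nat -> form -> Prop :=
| Pi_Delta0 p : Delta0 p -> Pi 0 p
| Pi_Sigma n p : Sigma n p -> Pi n.+1 p
| Pi_all n p : Pi n.+1 p -> Pi n.+1 (∀ p).

(** * Basic set-theoretic notions *)

Definition fNonempty x := ∃ (0 ∈ x.+1).
Definition fEmpty x := ¬ fNonempty x.
Definition fSub x y := ∀ (0 ∈ x.+1 → 0 ∈ y.+1).

(** p = {x, y} *)
Definition fPair p x y := ∀ (0 ∈ p.+1 ↔ 0 ≐ x.+1 ∨ 0 ≐ y.+1).

(** p = (x, y), the Kuratowski pair *)
Definition fOPair p x y :=
  ∃ ∃ (fPair 1 x.+2 x.+2 ∧ fPair 0 x.+2 y.+2 ∧ fPair p.+2 1 0).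

(** s = x ∪ {x} *)
Definition fSucc s x := ∀ (0 ∈ s.+1 ↔ 0 ∈ x.+1 ∨ 0 ≐ x.+1).

Definition fInductive i :=
  ∃ (fEmpty 0 ∧ 0 ∈ i.+1) ∧ ∀ (0 ∈ i.+1 → ∃ (fSucc 0 1 ∧ 0 ∈ i.+2)).

Definition fOmega w := fInductive w ∧ ∀ (fInductive 0 → fSub w.+1 0).

Definition fNat n := ∃ (fOmega 0 ∧ n.+1 ∈ 0).

(** (x, y) ∈ f *)
Definition fApp f x y := ∃ (fOPair 0 x.+1 y.+1 ∧ 0 ∈ f.+1).

(** f : d -> c *)
Definition fFun f d c :=
  ∀ (0 ∈ f.+1 → ∃ ∃ (1 ∈ d.+3 ∧ 0 ∈ c.+3 ∧ fOPair 2 1 0)) ∧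
  ∀ (0 ∈ d.+1 → ∃ ∀ (fApp f.+3 2 0 ↔ 0 ≐ 1)).

(** s is the restriction of f to n *)
Definition fRestr s f n :=
  ∀ (0 ∈ s.+1 ↔ 0 ∈ f.+1 ∧ ∃ ∃ (1 ∈ n.+3 ∧ fOPair 2 1 0)).

(** * ZF *)

Definition ax_ext := ∀ ∀ (∀ (0 ∈ 2 ↔ 0 ∈ 1) → 1 ≐ 0).
Definition ax_found := ∀ (fNonempty 0 → ∃ (0 ∈ 1 ∧ ¬ ∃ (0 ∈ 2 ∧ 0 ∈ 1))).
Definition ax_pair := ∀ ∀ ∃ (fPair 0 2 1).
Definition ax_union := ∀ ∃ ∀ (0 ∈ 1 ↔ ∃ (0 ∈ 3 ∧ 1 ∈ 0)).
Definition ax_power := ∀ ∃ ∀ (0 ∈ 1 ↔ fSub 0 2).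
Definition ax_inf := ∃ (fInductive 0).

(** ∀a ∃b ∀x (x ∈ b ↔ x ∈ a ∧ phi(x)); in [phi], the index 0 is x and the
    others are parameters. *)
Definition ax_sep (phi : form) :=
  ∀ ∃ ∀ (0 ∈ 1 ↔ 0 ∈ 2 ∧ ren (fun i => if i is j.+1 then j + 3 else 0) phi).

(** ∀x ∀y ∀z (phi(x,y) ∧ phi(x,z) → y = z) →
      ∀a ∃b ∀y (y ∈ b ↔ ∃x (x ∈ a ∧ phi(x,y)));
    in [phi], the index 0 is y, 1 is x, and the others are parameters. *)
Definition ax_repl (phi : form) :=
  let phi_at x y k :=
    ren (fun i => match i with 0 => y | 1 => x | j.+2 => j + k end) phi in
  ∀ ∀ ∀ (phi_at 2 1 3 ∧ phi_at 2 0 3 → 1 ≐ 0) →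
  ∀ ∃ ∀ (0 ∈ 1 ↔ ∃ (0 ∈ 3 ∧ phi_at 0 1 4)).

(** The schemas are universally closed over their parameters. *)
Inductive ZF : form -> Prop :=
| ZF_ext : ZF ax_ext
| ZF_found : ZF ax_found
| ZF_pair : ZF ax_pair
| ZF_union : ZF ax_union
| ZF_power : ZF ax_power
| ZF_inf : ZF ax_inf
| ZF_sep phi n : free_below n (ax_sep phi) -> ZF (iter n fAll (ax_sep phi))
| ZF_repl phi n : free_below n (ax_repl phi) -> ZF (iter n fAll (ax_repl phi)).

(** * Two-player games of perfect information and length ω

    A game is a pair (M, W): M is the nonempty set of moves and W is the set
    of plays, i.e. of functions x : ω -> M, that are won by player I; all other
    plays are won by player II.  Player I makes the moves x(n) with n even,
    player II those with n odd. *)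

(** n is a natural number and some e satisfies 0 ∈ e, n ∈ e, and
    k + 1 ∈ e ↔ k ∉ e for all k < n. *)
Definition fEven n :=
  fNat n ∧
  ∃ (∃ (fEmpty 0 ∧ 0 ∈ 1) ∧
     ∀ (0 ∈ n.+2 → ∃ (fSucc 0 1 ∧ (0 ∈ 2 ↔ ¬ (1 ∈ 2)))) ∧
     n.+1 ∈ 0).
Definition fOdd n := fNat n ∧ ¬ fEven n.

Definition fPlay x M := ∃ (fOmega 0 ∧ fFun x.+1 0 M.+1).

Definition fGame M W := fNonempty M ∧ ∀ (0 ∈ W.+1 → fPlay 0 M.+1).

(** Below, [turn] is [fEven] for player I and [fOdd] for player II. *)

(** s is a finite sequence in M whose length n satisfies [turn] *)
Definition fPosition (turn : nat -> form) s M := ∃ (turn 0 ∧ fFun s.+1 0 M.+1).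

(** t is a function to M from the set of all positions *)
Definition fStrategy (turn : nat -> form) t M :=
  ∃ (∀ (0 ∈ 1 ↔ fPosition turn 0 M.+2) ∧ fFun t.+1 0 M.+1).

(** x(n) = t(x restricted to n) whenever [turn] holds of n *)
Definition fFollows (turn : nat -> form) x t :=
  ∀ (turn 0 → ∃ ∃ (fRestr 1 x.+3 2 ∧ fApp x.+3 2 0 ∧ fApp t.+3 1 0)).

Definition fWinningI M W t :=
  fStrategy fEven t M ∧
  ∀ (fPlay 0 M.+1 ∧ fFollows fEven 0 t.+1 → 0 ∈ W.+1).
Definition fWinningII M W t :=
  fStrategy fOdd t M ∧
  ∀ (fPlay 0 M.+1 ∧ fFollows fOdd 0 t.+1 → ¬ (0 ∈ W.+1)).

(** For [phi] with no free variable but 0: M is the only set satisfying [phi] *)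
Definition fUniquely (phi : form) M := ∀ (phi ↔ 0 ≐ M.+1).

(** For [phi] with no free variable but 0: W = {x | phi(x)} *)
Definition fExtension (phi : form) W := ∀ (0 ∈ W.+1 ↔ phi).

(* Main.v *)
(** By completeness one may argue in an arbitrary model of ZF. Let M be the
    power set of the power set of ω, and write S ~ T when S, T ⊆ ω agree up to a
    finite set. Player I first plays some f ∈ M.

    If f = {S | S ~ e or S ~ ω∖e} for some e, then II must answer with a g that
    is closed under ~ in f and contains exactly one of any two complementary
    members of f; II wins iff the answer is of this kind. If f itself behaves in
    this way on all subsets of ω, then the players go on with natural numbers
    x(1) < x(2) < ..., the first violation loses, and k is taken by the player
    who first plays a number above k; I wins iff the set of the numbers taken by
    I is in f. In all other cases I loses.

    Answering correctly is always possible, so a winning strategy of I would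
    have to open with an f of the second kind. A winning strategy of II picks
    one half of every set of the first kind, which yields an f of the second
    kind, and I may open with it. In either case the opponent of the strategy
    plays two games at once: in one of them an additional number is played,
    and from then on each reply of the strategy in one game is copied as the
    next move in the other. Up to finitely many numbers the two games then end
    with exchanged territories, so that the strategy loses one of them. *)

From Stdlib Require Import Classical ClassicalEpsilon.
From Stdlib Require Import FunctionalExtensionality PropExtensionality.
From Stdlib Require List.
Require Import Defs.
From mathcomp Require Import all_boot.

Set Implicit Arguments.
Unset Strict Implicit.
Unset Printing Implicit Defensive.

Local Open Scope form_scope.

(** * Completeness of natural deduction *)

Lemma In_map (A B : Type) (f : A -> B) x s :
  List.In x s -> List.In (f x) (map f s).
Proof. by elim: s => //= y s IH [->|/IH]; [left | right]. Qed.

Lemma In_mapE (A B : Type) (f : A -> B) y s :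
  List.In y (map f s) -> exists2 x, List.In x s & f x = y.
Proof.
by elim: s => //= z s IH [<-|/IH [x ? ?]]; [exists z | exists x]; auto.
Qed.

Lemma In_cat (A : Type) (x : A) s1 s2 :
  List.In x (s1 ++ s2) <-> List.In x s1 \/ List.In x s2.
Proof. by elim: s1 => /= [|y s IH]; tauto. Qed.

Lemma ren_ext_below n r s p :
  (forall i, i < n -> r i = s i) -> free_below n p -> ren r p = ren s p.
Proof.
elim: p n r s => //= [x y|x y|p IHp q IHq|p IHp q IHq|p IHp q IHq|p IH|p IH] n r s E.
1,2: by case/andP=> /E -> /E ->.
1-3: by case/andP=> /(IHp _ _ _ E) -> /(IHq _ _ _ E) ->.
all: by move/(IH n.+1 (up r) (up s)) => -> // -[|i] //= /E ->.
Qed.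

Lemma ren_ext r s p : r =1 s -> ren r p = ren s p.
Proof.
elim: p r s => //= [x y|x y|p IHp q IHq|p IHp q IHq|p IHp q IHq|p IH|p IH] r s E.
1,2: by rewrite !E.
1-3: by rewrite (IHp _ _ E) (IHq _ _ E).
all: by congr (_ _); apply: IH => -[|i] //=; rewrite E.
Qed.

Lemma ren_comp r s p : ren r (ren s p) = ren (fun i => r (s i)) p.
Proof.
elim: p r s => //= [p IHp q IHq|p IHp q IHq|p IHp q IHq|p IH|p IH] r s.
1-3: by rewrite IHp IHq.
all: by rewrite IH; congr (_ _); apply: ren_ext => -[|i].
Qed.

Lemma ren_id r p : r =1 id -> ren r p = p.
Proof.
elim: p r => //= [x y|x y|p IHp q IHq|p IHp q IHq|p IHp q IHq|p IH|p IH] r E.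
1,2: by rewrite !E.
1-3: by rewrite IHp // IHq.
all: by rewrite IH // => -[|i] //=; rewrite E.
Qed.

Lemma ren_closed r p : free_below 0 p -> ren r p = p.
Proof. by move=> c; rewrite -[RHS](@ren_id id) //; apply: ren_ext_below c. Qed.

Lemma free_below_leq n m p : n <= m -> free_below n p -> free_below m p.
Proof.
elim: p n m => //= [x y|x y|p IHp q IHq|p IHp q IHq|p IHp q IHq|p IH|p IH] n m le.
1,2: by case/andP=> /leq_trans-> // /leq_trans->.
1-3: by case/andP=> /(IHp _ _ le)-> /(IHq _ _ le)->.
all: exact: IH.
Qed.

Fixpoint free_bound (p : form) : nat :=
  match p with
  | fBot => 0
  | fMem x y | fEq x y => (maxn x y).+1
  | fImp p q | fAnd p q | fOr p q => maxn (free_bound p) (free_bound q)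
  | fAll p | fEx p => free_bound p
  end.

Lemma free_boundP p : free_below (free_bound p) p.
Proof.
elim: p => //= [x y|x y|p IHp q IHq|p IHp q IHq|p IHp q IHq|p IH|p IH].
1,2: by rewrite !ltnS leq_maxl leq_maxr.
1-3: by rewrite (free_below_leq _ IHp) ?leq_maxl // (free_below_leq _ IHq) ?leq_maxr.
all: exact: free_below_leq IH.
Qed.

(** Needed because the rules for quantifiers shift the context: a renaming passes under the binder
    as [up r]. *)
Lemma map_ren_up r G :
  map (ren (up r)) (map shift G) = map shift (map (ren r) G).
Proof. by rewrite -!map_comp; apply: eq_map => p /=; rewrite /shift !ren_comp. Qed.

Lemma ren_inst r x p : ren r (inst x p) = inst (r x) (ren (up r) p).
Proof. by rewrite /inst !ren_comp; apply: ren_ext => -[|i]. Qed.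

Lemma prv_ren r G p : prv G p -> prv (map (ren r) G) (ren r p).
Proof.
move=> H; elim: H r => {G p} [G p Gp|G p _ IH|G p q _ IH|G p q _ IH1 _ IH2
  |G p q _ IH1 _ IH2|G p q _ IH|G p q _ IH|G p q _ IH|G p q _ IH
  |G p q s _ IH1 _ IH2 _ IH3|G p _ IH|G p x _ IH|G p x _ IH|G p q _ IH1 _ IH2
  |G x|G p x y _ IH1 _ IH2] r.
- exact/prv_ax/In_map.
- exact/prv_raa/IH.
- exact/prv_impI/IH.
- exact: prv_impE (IH1 r) (IH2 r).
- exact: prv_andI (IH1 r) (IH2 r).
- exact: prv_andE1 (IH r).
- exact: prv_andE2 (IH r).
- exact: prv_orI1 (IH r).
- exact: prv_orI2 (IH r).
- exact: prv_orE (IH1 r) (IH2 r) (IH3 r).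
- by apply: prv_allI; rewrite -map_ren_up.
- by rewrite ren_inst; apply: prv_allE (IH r).
- by apply: (@prv_exI _ _ (r x)); rewrite -ren_inst.
- apply: prv_exE (IH1 r) _; rewrite -map_ren_up.
  have -> : shift (ren r q) = ren (up r) (shift q) by rewrite /shift !ren_comp.
  exact: IH2.
- exact: prv_eqI.
- by rewrite ren_inst; apply: prv_eqE (IH1 r) _; rewrite -ren_inst.
Qed.

Lemma prv_weak G G' p :
  (forall q, List.In q G -> List.In q G') -> prv G p -> prv G' p.
Proof.
have sub_cons (A A' : seq form) (q : form) :
    (forall s, List.In s A -> List.In s A') ->
    forall s, List.In s (q :: A) -> List.In s (q :: A').
  by move=> h s /= [->|/h]; [left | right].
have sub_map (A A' : seq form) : (forall s, List.In s A -> List.In s A') ->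
    forall s, List.In s (map shift A) -> List.In s (map shift A').
  by move=> h s H; case: (In_mapE H) => q Aq <-; apply/In_map/h.
move=> s H; elim: H G' s => {G p} [G p Gp|G p _ IH|G p q _ IH|G p q _ IH1 _ IH2
  |G p q _ IH1 _ IH2|G p q _ IH|G p q _ IH|G p q _ IH|G p q _ IH
  |G p q r _ IH1 _ IH2 _ IH3|G p _ IH|G p x _ IH|G p x _ IH|G p q _ IH1 _ IH2
  |G x|G p x y _ IH1 _ IH2] G' s.
- exact/prv_ax/s.
- exact/prv_raa/IH/sub_cons.
- exact/prv_impI/IH/sub_cons.
- exact: prv_impE (IH1 _ s) (IH2 _ s).
- exact: prv_andI (IH1 _ s) (IH2 _ s).
- exact: prv_andE1 (IH _ s).
- exact: prv_andE2 (IH _ s).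
- exact: prv_orI1 (IH _ s).
- exact: prv_orI2 (IH _ s).
- by apply: prv_orE (IH1 _ s) (IH2 _ _) (IH3 _ _); apply: sub_cons.
- exact/prv_allI/IH/sub_map.
- exact: prv_allE (IH _ s).
- by apply: (@prv_exI _ _ x); apply: IH.
- by apply: prv_exE (IH1 _ s) (IH2 _ _); apply/sub_cons/sub_map.
- exact: prv_eqI.
- exact: prv_eqE (IH1 _ s) (IH2 _ s).
Qed.

(** * Countability of the language *)

Fixpoint form_tree (p : form) : GenTree.tree nat :=
  match p with
  | fBot => GenTree.Node 0 [::]
  | fMem x y => GenTree.Node 1 [:: GenTree.Leaf x; GenTree.Leaf y]
  | fEq x y => GenTree.Node 2 [:: GenTree.Leaf x; GenTree.Leaf y]
  | fImp p q => GenTree.Node 3 [:: form_tree p; form_tree q]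
  | fAnd p q => GenTree.Node 4 [:: form_tree p; form_tree q]
  | fOr p q => GenTree.Node 5 [:: form_tree p; form_tree q]
  | fAll p => GenTree.Node 6 [:: form_tree p]
  | fEx p => GenTree.Node 7 [:: form_tree p]
  end.

Fixpoint tree_form (t : GenTree.tree nat) : form :=
  match t with
  | GenTree.Node 1 [:: GenTree.Leaf x; GenTree.Leaf y] => fMem x y
  | GenTree.Node 2 [:: GenTree.Leaf x; GenTree.Leaf y] => fEq x y
  | GenTree.Node 3 [:: p; q] => fImp (tree_form p) (tree_form q)
  | GenTree.Node 4 [:: p; q] => fAnd (tree_form p) (tree_form q)
  | GenTree.Node 5 [:: p; q] => fOr (tree_form p) (tree_form q)
  | GenTree.Node 6 [:: p] => fAll (tree_form p)
  | GenTree.Node 7 [:: p] => fEx (tree_form p)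
  | _ => fBot
  end.

Lemma form_treeK : cancel form_tree tree_form.
Proof. by elim=> //= [p IHp q IHq|p IHp q IHq|p IHp q IHq|p IHp|p IHp]; rewrite ?IHp ?IHq. Qed.

(** An enumeration with repetitions: numbers that code no tree yield [⊥]. Surjectivity is what the
    Henkin construction asks for. *)
Definition nth_form (k : nat) : form :=
  if unpickle k is Some t then tree_form t else fBot.

Lemma nth_form_surj p : exists k, nth_form k = p.
Proof. by exists (pickle (form_tree p)); rewrite /nth_form pickleK form_treeK. Qed.

(** * Tarski semantics and provability from a theory *)

Definition scons (D : Type) (d : D) (rho : nat -> D) (i : nat) : D :=
  if i is j.+1 then rho j else d.

Fixpoint sat (D : Type) (E : D -> D -> Prop) (rho : nat -> D) (p : form) : Prop :=
  match p with
  | fBot => False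
  | fMem x y => E (rho x) (rho y)
  | fEq x y => rho x = rho y
  | fImp p q => sat E rho p -> sat E rho q
  | fAnd p q => sat E rho p /\ sat E rho q
  | fOr p q => sat E rho p \/ sat E rho q
  | fAll p => forall d, sat E (scons d rho) p
  | fEx p => exists d, sat E (scons d rho) p
  end.

Definition extend (T : form -> Prop) (p q : form) : Prop := T q \/ q = p.

Section Theories.
Variable T : form -> Prop.

Lemma proves_mono (T' : form -> Prop) p :
  (forall q, T q -> T' q) -> proves T p -> proves T' p.
Proof. by move=> s [G GT H]; exists G => // q /GT /s. Qed.

Lemma proves_ax p : T p -> proves T p.
Proof. by move=> Tp; exists [:: p]; [move=> q /= [<-|] | apply: prv_ax; left]. Qed.

Lemma proves_rule1 p q :
  (forall G, prv G p -> prv G q) -> proves T p -> proves T q.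
Proof. by move=> R [G GT H]; exists G; auto. Qed.

Lemma proves_rule2 p q r :
  (forall G, prv G p -> prv G q -> prv G r) ->
  proves T p -> proves T q -> proves T r.
Proof.
move=> R [G GT H] [G' GT' H']; exists (G ++ G').
  by move=> s /In_cat[/GT|/GT'].
by apply: R; [apply: prv_weak H | apply: prv_weak H'] => s; rewrite In_cat; auto.
Qed.

(** The finitely many hypotheses may mention [p] several times and in any place; weakening gathers
    these occurrences at the head, where the rules can discharge them. *)
Lemma proves_extend p q :
  proves (extend T p) q -> exists2 G, (forall r, List.In r G -> T r) & prv (p :: G) q.
Proof.
move=> [G GT H].
have [G' GT' sG] : exists2 G', (forall r, List.In r G' -> T r) &
    forall r, List.In r G -> List.In r (p :: G').
  elim: G GT {H} => [|r G IH] GT; first by exists [::].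
  have [|G' GT' sG] := IH; first by move=> s ?; apply: GT; right.
  case: (GT r (or_introl erefl)) => [Tr|->].
    exists (r :: G'); first by move=> s /= [<-|/GT'].
    by move=> s /= [->|/sG[]]; auto.
  by exists G' => // s /= [->|/sG]; auto.
by exists G' => //; apply: prv_weak H.
Qed.

Lemma proves_imp p q : proves (extend T p) q -> proves T (p → q).
Proof. by case/proves_extend=> G GT H; exists G => //; apply: prv_impI. Qed.

Lemma proves_raa p : proves (extend T (¬ p)) ⊥ -> proves T p.
Proof. by case/proves_extend=> G GT H; exists G => //; apply: prv_raa. Qed.

End Theories.

Lemma prv_botE G p : prv G ⊥ -> prv G p.
Proof. by move=> H; apply: prv_raa; apply: prv_weak H => q; right. Qed.

(** The classical quantifier law that lets witnesses for [∃] serve as counterexamples to [∀]. *)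
Lemma prv_not_all G p : prv G (¬ ∀ p) -> prv G (∃ (¬ p)).
Proof.
move=> H; apply: prv_raa.
apply: prv_impE (prv_weak _ H) _ => [q|]; first by right.
apply: prv_allI; apply: prv_raa.
apply: (@prv_impE _ (∃ ¬ ren (up succn) p)); first by apply: prv_ax; right; left.
(* The eigenvariable of the generalisation is 0, so it is the witness. *)
apply: (@prv_exI _ _ 0); rewrite /inst /= ren_comp ren_id; last by case.
by apply: prv_ax; left.
Qed.

(** * Henkin extension and the model of variables modulo provable equality *)

Section Henkin.
Variables (T : form -> Prop) (phi : form).
Hypothesis closedT : forall p, T p -> free_below 0 p.
Hypothesis closed_phi : free_below 0 phi.
Hypothesis unprovable : ~ proves T phi.

Definition theory (L : seq form) (p : form) : Prop := T p \/ List.In p L.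

Definition consistent (S : form -> Prop) : Prop := ~ proves S ⊥.

Definition seq_bound (L : seq form) : nat := \max_(p <- L) free_bound p.

Lemma seq_boundP L p : List.In p L -> free_below (seq_bound L) p.
Proof.
rewrite /seq_bound; elim: L => //= q L IH; rewrite big_cons => -[<-|/IH].
  by apply: free_below_leq (free_boundP q); rewrite leq_maxl.
by apply: free_below_leq; rewrite leq_maxr.
Qed.

(** The variable [seq_bound (p :: L)] is free in no formula of the list, and [T] is closed, so it
    acts as a fresh Henkin constant. *)
Definition witness (L : seq form) (p : form) : seq form :=
  if p is fEx q then [:: inst (seq_bound (p :: L)) q, p & L] else p :: L.

Definition step (L : seq form) (p : form) : seq form :=
  if excluded_middle_informative (consistent (theory (p :: L)))
  then witness L p else L.

Fixpoint stage (n : nat) : seq form :=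
  if n is k.+1 then step (stage k) (nth_form k) else [:: ¬ phi].

Definition limit (p : form) : Prop := exists n, theory (stage n) p.

Lemma ex_bound (L : seq form) (q : form) :
  List.In (∃ q) L -> free_below (seq_bound L).+1 q.
Proof. by move/seq_boundP. Qed.

(** A refutation that uses the instance at the fresh variable becomes, after renaming, the premise
    of an [∃] elimination, which refutes [L] already. *)
Lemma consistent_witness L q :
  List.In (∃ q) L -> consistent (theory L) ->
  consistent (theory (inst (seq_bound L) q :: L)).
Proof.
set N := seq_bound L => Lq con bad; apply: con.
have {bad} [] : proves (extend (theory L) (inst N q)) ⊥.
  apply: proves_mono bad => r [Tr|/= [<-|Lr]]; first by left; left.
  - by right.
  - by left; right.
move=> G0 G0T H0; have /proves_extend[G GT H] : proves (extend (theory L) (inst N q)) ⊥.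
  by exists G0.
exists (∃ q :: G); first by move=> r /= [<-|/GT]; [right | ].
apply: (prv_exE (p := q)); first by apply: prv_ax; left.
(* The fresh variable becomes the bound one; on formulas without it, [r] is the shift that [prv_exE]
   demands. *)
pose r i := if i == N then 0 else i.+1.
have rE p : free_below N p -> ren r p = shift p.
  by apply: ren_ext_below => i; rewrite /r; case: ltngtP.
have := prv_ren r H; apply: prv_weak => p /= [<-|]; last first.
  move=> H'; case: (In_mapE H') => p' Gp' <-; right; right.
  rewrite rE; first exact: In_map.
  by case: (GT _ Gp') => [/closedT|/seq_boundP //]; apply: free_below_leq.
left; rewrite /inst ren_comp -[LHS](@ren_id id) //.
apply: (@ren_ext_below N.+1); last exact: ex_bound.
by case=> [|i] /=; rewrite /r ?eqxx // ltnS; case: ltngtP.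
Qed.

Lemma consistent_step L p : consistent (theory L) -> consistent (theory (step L p)).
Proof.
rewrite /step; case: excluded_middle_informative => // con _.
case: p con => //= q con.
by apply: consistent_witness => //; left.
Qed.

Lemma consistent_stage n : consistent (theory (stage n)).
Proof.
elim: n => [|n IH]; last exact: consistent_step.
move=> bad; apply: unprovable; apply: proves_raa; apply: proves_mono bad.
by move=> p [|/= [<-|//]]; [left | right].
Qed.

Lemma stage_mono m n p : m <= n -> theory (stage m) p -> theory (stage n) p.
Proof.
move=> mn H; have [d ->] : exists d, n = d + m by exists (n - m); rewrite subnK.
elim: d => [//|d [Tp|Lp]]; first by left.
right; rewrite addSn /= /step; case: excluded_middle_informative => //= _.
by case: (nth_form _) => * /=; auto.
Qed.

Lemma consistent_limit : consistent limit.
Proof.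
move=> [G GT H].
have [n Gn] : exists n, forall p, List.In p G -> theory (stage n) p.
  elim: G GT {H} => [|p G IH] GT; first by exists 0.
  have [|n Gn] := IH; first by move=> q ?; apply: GT; right.
  have [m pm] := GT p (or_introl erefl).
  exists (maxn m n) => q /= [<-|/Gn].
    by apply: stage_mono pm; rewrite leq_maxl.
  by apply: stage_mono; rewrite leq_maxr.
by apply: (@consistent_stage n); exists G.
Qed.

(** Every formula has its turn at some stage, and is rejected there only if it contradicts that
    stage. *)
Lemma limit_decides p : limit p \/ proves limit (¬ p).
Proof.
have [k Ek] := nth_form_surj p.
have [con|] := classic (consistent (theory (p :: stage k))).
  left; exists k.+1; right; rewrite /= /step Ek.
  by case: excluded_middle_informative => //= _; case: (p) => * /=; auto.
move=> /NNPP bad; right; apply: proves_imp; apply: proves_mono bad => q.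
case=> [Tq|/= [<-|Lq]]; first by left; exists k; left.
  by right.
by left; exists k; right.
Qed.

Lemma limit_closed p : proves limit p -> limit p.
Proof.
move=> H; have [//|N] := limit_decides p; case: consistent_limit.
by apply: proves_rule2 N H => G; apply: prv_impE.
Qed.

(** When [∃ q] has its turn it is consistent with the stage, since both lie in the consistent limit;
    so it enters together with its witness. *)
Lemma limit_witness q : limit (∃ q) -> exists x, limit (inst x q).
Proof.
move=> H; have [k Ek] := nth_form_surj (∃ q).
exists (seq_bound (∃ q :: stage k)), k.+1; right; rewrite /= /step Ek.
case: excluded_middle_informative => /= [_|]; first by left.
case=> bad; apply: consistent_limit; apply: proves_mono bad => p.
by case=> [Tp|/= [<- //|Lp]]; exists k; [left | right].
Qed.

Notation pv := (proves limit).

Lemma pv_bot : ~ pv ⊥.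
Proof. exact: consistent_limit. Qed.

Lemma pv_imp p q : pv (p → q) <-> (pv p -> pv q).
Proof.
split=> [H|H]; first by apply: proves_rule2 H => G; apply: prv_impE.
have [/proves_ax/H|] := limit_decides p; apply: proves_rule1 => G {}H.
  by apply: prv_impI; apply: prv_weak H => r; right.
apply: prv_impI; apply: prv_botE; apply: prv_impE (prv_weak _ H) _ => [r|].
  by right.
by apply: prv_ax; left.
Qed.

Lemma pv_not p : pv (¬ p) <-> ~ pv p.
Proof. by rewrite pv_imp; split=> H /H //; move/pv_bot. Qed.

Lemma pv_and p q : pv (p ∧ q) <-> pv p /\ pv q.
Proof.
split=> [H|[]]; last by apply: proves_rule2 => G; apply: prv_andI.
by split; apply: proves_rule1 H => G; [apply: prv_andE1 | apply: prv_andE2].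
Qed.

Lemma pv_or p q : pv (p ∨ q) <-> pv p \/ pv q.
Proof.
split=> [H|[]]; last 2 first.
- by apply: proves_rule1 => G; apply: prv_orI1.
- by apply: proves_rule1 => G; apply: prv_orI2.
apply: NNPP => /not_or_and[/pv_not Np /pv_not Nq]; apply: pv_bot.
have N : pv (¬ p ∧ ¬ q) by apply/pv_and.
apply: proves_rule2 H N => G H N; apply: prv_orE H _ _.
  apply: (@prv_impE _ p); last by apply: prv_ax; left.
  by apply: prv_andE1 (prv_weak _ N) => r; right.
apply: (@prv_impE _ q); last by apply: prv_ax; left.
by apply: prv_andE2 (prv_weak _ N) => r; right.
Qed.

Lemma pv_ex p : pv (∃ p) <-> exists x, pv (inst x p).
Proof.
split=> [/limit_closed/limit_witness[x /proves_ax]|[x]]; first by exists x.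
by apply: proves_rule1 => G; apply: prv_exI.
Qed.

(** An unprovable universal formula makes [∃ (¬ p)] provable, whose witness is an instance that
    fails. *)
Lemma pv_all p : pv (∀ p) <-> forall x, pv (inst x p).
Proof.
split=> [H x|H]; first by apply: proves_rule1 H => G; apply: prv_allE.
apply: NNPP => /pv_not /(proves_rule1 (@prv_not_all ^~ p)).
by case/pv_ex=> x; rewrite /inst /= => /pv_not; apply; apply: H.
Qed.

Lemma pv_eqE p x y : pv (x ≐ y) -> pv (inst x p) -> pv (inst y p).
Proof. by apply: proves_rule2 => G; apply: prv_eqE. Qed.

Lemma pv_refl x : pv (x ≐ x).
Proof. by exists [::] => //; apply: prv_eqI. Qed.

Lemma pv_sym x y : pv (x ≐ y) -> pv (y ≐ x).
Proof. by move/(@pv_eqE (0 ≐ x.+1)); apply; apply: pv_refl. Qed.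

Lemma pv_trans x y z : pv (x ≐ y) -> pv (y ≐ z) -> pv (x ≐ z).
Proof. by move=> xy yz; apply: (@pv_eqE (x.+1 ≐ 0) y z). Qed.

(** Since [sat] reads [≐] as true equality, the domain must be a quotient; it is realised by one
    chosen representative per class of provably equal variables. *)
Definition repr (x : nat) : nat := epsilon (inhabits 0) (fun y => pv (x ≐ y)).

Lemma pv_repr x : pv (x ≐ repr x).
Proof.
apply: (epsilon_spec (inhabits 0) (fun y => pv (x ≐ y))).
by exists x; apply: pv_refl.
Qed.

Lemma repr_eq x y : pv (x ≐ y) -> repr x = repr y.
Proof.
(* Equal classes are equal predicates by extensionality, so [epsilon] picks the same representative
   from them. *)
move=> xy; congr epsilon; apply: functional_extensionality => z.
apply: propositional_extensionality; split; last exact: pv_trans.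
exact/pv_trans/pv_sym.
Qed.

Lemma repr_idem x : repr (repr x) == repr x.
Proof. by apply/eqP/esym/repr_eq/pv_repr. Qed.

Definition dom := {x : nat | repr x == x}.

Definition mem (d e : dom) : Prop := pv (val d ∈ val e).

Definition cl (x : nat) : dom := exist _ (repr x) (repr_idem x).

Lemma inst_up (rho : nat -> dom) (d : dom) p :
  inst (val d) (ren (up (fun i => val (rho i))) p) =
  ren (fun i => val (scons d rho i)) p.
Proof. by rewrite /inst ren_comp; apply: ren_ext => -[]. Qed.

Lemma pv_inst_cl p x : pv (inst x p) <-> pv (inst (val (cl x)) p).
Proof.
by split; apply: pv_eqE; [apply: pv_repr | apply/pv_sym/pv_repr].
Qed.

(** The truth lemma, by induction on [p]: maximality handles the connectives and witnesses handle
    the quantifiers. Every variable may be replaced by its representative, so quantifying over [dom]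
    loses nothing. *)
Lemma truth (rho : nat -> dom) p :
  sat mem rho p <-> pv (ren (fun i => val (rho i)) p).
Proof.
elim: p rho => //= [|x y|p IHp q IHq|p IHp q IHq|p IHp q IHq|p IH|p IH] rho.
- by split=> // /pv_bot.
- split=> [->|/repr_eq E]; first exact: pv_refl.
  by apply: val_inj; rewrite -(eqP (valP (rho x))) -(eqP (valP (rho y))).
- by rewrite pv_imp IHp IHq.
- by rewrite pv_and IHp IHq.
- by rewrite pv_or IHp IHq.
- rewrite pv_all; split=> [H x|H d]; last by apply/IH; rewrite -inst_up.
  by apply/pv_inst_cl; rewrite inst_up; apply/IH.
- rewrite pv_ex; split=> [[d /IH]|[x /pv_inst_cl]].
    by rewrite -inst_up; exists (val d).
  by rewrite inst_up => /IH; exists (cl x).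
Qed.

Lemma countermodel :
  exists (D : Type) (E : D -> D -> Prop) (rho : nat -> D),
    (forall p, T p -> forall rho', sat E rho' p) /\ ~ sat E rho phi.
Proof.
exists dom, mem, (fun=> cl 0); split=> [p Tp rho'|].
  apply/truth; rewrite ren_closed; last exact: closedT.
  by apply: proves_ax; exists 0; left.
move/truth; rewrite ren_closed //; apply/pv_not/proves_ax.
by exists 0; right; left.
Qed.

End Henkin.

Theorem completeness (T : form -> Prop) (phi : form) :
  (forall p, T p -> free_below 0 p) -> free_below 0 phi ->
  (forall (D : Type) (E : D -> D -> Prop) (rho : nat -> D),
     (forall p, T p -> forall rho', sat E rho' p) -> sat E rho phi) ->
  proves T phi.
Proof.
move=> cT cphi H; apply: NNPP => /(countermodel cT cphi)[D [E [rho [ET]]]].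
by apply; apply: H.
Qed.
(** * Reading formulas in a structure *)

Lemma sat_ext (D : Type) (E : D -> D -> Prop) p rho rho' :
  rho =1 rho' -> sat E rho p <-> sat E rho' p.
Proof.
elim: p rho rho' => //= [x y|x y|p IHp q IHq|p IHp q IHq|p IHp q IHq|p IH|p IH] r s e.
1,2: by rewrite !e.
1-3: by rewrite (IHp _ _ e) (IHq _ _ e).
all: have H d : sat E (scons d r) p <-> sat E (scons d s) p by apply: IH => -[|i] /=.
- by split=> h d; apply/H.
- by split=> -[d h]; exists d; apply/H.
Qed.

Lemma sat_ren (D : Type) (E : D -> D -> Prop) p r rho :
  sat E rho (ren r p) <-> sat E (fun i => rho (r i)) p.
Proof.
elim: p r rho => //= [p IHp q IHq|p IHp q IHq|p IHp q IHq|p IH|p IH] r rho.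
1-3: by rewrite IHp IHq.
all: have H d : sat E (scons d rho) (ren (up r) p) <->
    sat E (scons d (fun i => rho (r i))) p
  by rewrite IH; apply: sat_ext => -[].
- by split=> h d; apply/H.
- by split=> -[d h]; exists d; apply/H.
Qed.

(** Peels off the universal closure of an axiom schema: the outermost variable takes the value
    [rho 0], the rest of [rho] is the outer assignment. *)
Lemma sat_iter_all (D : Type) (E : D -> D -> Prop) n p :
  (forall rho, sat E rho (iter n fAll p)) -> forall rho, sat E rho p.
Proof.
elim: n => //= n IH H; apply: IH => rho.
have /= := H (fun i => rho i.+1) (rho 0).
have e : scons (rho 0) (fun i => rho i.+1) =1 rho by case.
by case: (sat_ext E (iter n fAll p) e).
Qed.

Lemma free_below_iter n m p : free_below (n + m) p -> free_below m (iter n fAll p).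
Proof. by elim: n m => //= n IH m; rewrite addSnnS; apply: IH. Qed.

Lemma ZF_closed p : ZF p -> free_below 0 p.
Proof. by case=> // q n; rewrite -[in free_below n _](addn0 n); apply: free_below_iter. Qed.

(** [reify] solves [sat E rho ?phi <-> Q] by building [phi] from the shape of
    the proposition [Q]: the elements of the structure occurring in [Q] are
    looked up in the environment [rho], and are added to it when its tail is
    still an existential variable. *)
Section Reify.
Variables (D : Type) (E : D -> D -> Prop) (rho : nat -> D).
Implicit Types (p q : form) (P Q : Prop).

Lemma reify_bot : sat E rho ⊥ <-> False.
Proof. by []. Qed.

Lemma reify_mem i j : sat E rho (i ∈ j) <-> E (rho i) (rho j).
Proof. by []. Qed.

Lemma reify_eq i j : sat E rho (i ≐ j) <-> rho i = rho j.
Proof. by []. Qed.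

Lemma reify_imp p q P Q :
  (sat E rho p <-> P) -> (sat E rho q <-> Q) -> sat E rho (p → q) <-> (P -> Q).
Proof. by move=> /= -> ->. Qed.

Lemma reify_not p P : (sat E rho p <-> P) -> sat E rho (¬ p) <-> ~ P.
Proof. by move=> /= ->. Qed.

Lemma reify_and p q P Q :
  (sat E rho p <-> P) -> (sat E rho q <-> Q) -> sat E rho (p ∧ q) <-> P /\ Q.
Proof. by move=> /= -> ->. Qed.

Lemma reify_or p q P Q :
  (sat E rho p <-> P) -> (sat E rho q <-> Q) -> sat E rho (p ∨ q) <-> P \/ Q.
Proof. by move=> /= -> ->. Qed.

Lemma reify_iff p q P Q :
  (sat E rho p <-> P) -> (sat E rho q <-> Q) -> sat E rho (p ↔ q) <-> (P <-> Q).
Proof. by move=> /= -> ->. Qed.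

Lemma reify_all p (P : D -> Prop) :
  (forall d, sat E (scons d rho) p <-> P d) ->
  sat E rho (∀ p) <-> (forall d, P d).
Proof. by move=> H /=; split=> h d; apply/H. Qed.

Lemma reify_ex p (P : D -> Prop) :
  (forall d, sat E (scons d rho) p <-> P d) ->
  sat E rho (∃ p) <-> (exists d, P d).
Proof. by move=> H /=; split=> -[d /H]; exists d. Qed.

(** Variables are the only terms of the language, so a set-theoretic operation inside [P] is named
    by an existential quantifier and a formula [p] defining its value. *)
Lemma reify_term p q t (P : D -> Prop) :
  (forall d, sat E (scons d rho) p <-> d = t) ->
  (forall d, sat E (scons d rho) q <-> P d) ->
  sat E rho (∃ (p ∧ q)) <-> P t.
Proof.
move=> Hp Hq /=; split=> [[d [/Hp -> /Hq //]]|Pt].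
by exists t; split; [apply/Hp | apply/Hq].
Qed.

End Reify.

Ltac find_var x rho :=
  lazymatch rho with
  | scons ?y ?r =>
      match goal with
      | _ => let _ := match goal with _ => constr_eq x y end in constr:(0)
      | _ => let n := find_var x r in constr:(n.+1)
      end
  | ?r =>
      match goal with
      | _ => lazymatch x with r ?i => i end
      | _ =>
        let _ := match goal with _ => first [is_var x | is_const x]; is_evar r end in
        let T := type of r in
        let _ := match goal with _ =>
          let r' := open_constr:(_ : T) in unify r (scons x r') end in
        constr:(0)
      end
  end.

Ltac not_var x rho := assert_fails (idtac; let i := find_var x rho in idtac).

Ltac head_of t := lazymatch t with ?f _ => head_of f | _ => t end.

(** To be extended with the definitions of the set-theoretic operations. *)
Ltac reify_def y := fail.

Ltac reify :=
  cbv beta;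
  lazymatch goal with
  | |- sat ?E ?rho _ <-> ?Q =>
    lazymatch Q with
    | False => apply reify_bot
    | _ /\ _ => apply reify_and; reify
    | _ \/ _ => apply reify_or; reify
    | ~ _ => apply reify_not; reify
    | _ <-> _ => apply reify_iff; reify
    | exists _, _ => apply reify_ex; intro; reify
    | forall d : ?A, _ =>
      lazymatch type of A with
      | Prop => apply reify_imp; reify
      | _ => apply reify_all; intro; reify
      end
    | E ?x ?y =>
      match goal with
      | _ => let i := find_var x rho in let j := find_var y rho in
             exact (@reify_mem _ E _ i j)
      | _ => let i := find_var x rho in not_var y rho;
             eapply (@reify_term _ E rho _ _ y (fun z => E x z)); intro; reify
      | _ => not_var x rho;
             eapply (@reify_term _ E rho _ _ x (fun z => E z y)); intro; reify
      end
    | ?x = ?y =>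
      match goal with
      | _ => let i := find_var x rho in let j := find_var y rho in
             exact (@reify_eq _ E _ i j)
      | _ => let i := find_var x rho in reify_op E rho x y
      | _ => not_var x rho;
             eapply (@reify_term _ E rho _ _ x (fun z => z = y)); intro; reify
      end
    | _ => let h := head_of Q in unfold h; reify
    end
  end
with reify_op E rho x y :=
  lazymatch y with
  | ?f ?a ?b =>
    match goal with
    | _ => let i := find_var a rho in let j := find_var b rho in
           reify_def y; reify
    | _ => let i := find_var a rho in not_var b rho;
           eapply (@reify_term _ E rho _ _ b (fun z => x = f a z)); intro; reify
    | _ => not_var a rho; eapply (@reify_term _ E rho _ _ a (fun z => x = f z b)); intro; reify
    end
  | ?f ?a =>
    match goal with
    | _ => let i := find_var a rho in reify_def y; reify
    | _ => not_var a rho; eapply (@reify_term _ E rho _ _ a (fun z => x = f z)); intro; reify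
    end
  | _ => reify_def y; reify
  end.

(** * The winning condition *)

Section Winning.
Variables (D : Type) (E : D -> D -> Prop).
Local Notation "x ∈ y" := (E x y).
Implicit Types (a b c f g i k m n o p s w x y z P M v S T : D).

(** This notion and the following ones are relational and bound every quantifier by a set at hand,
    so that [reify] turns them into [Delta0] formulas. *)
Definition d_empty o := forall u, u ∈ o -> False.
Definition d_sub x y := forall u, u ∈ x -> u ∈ y.
Definition d_succ s n :=
  (forall u, u ∈ s -> u ∈ n \/ u = n) /\ (forall u, u ∈ n -> u ∈ s) /\ n ∈ s.
Definition d_pair p x y := (forall u, u ∈ p -> u = x \/ u = y) /\ x ∈ p /\ y ∈ p.
Definition d_opair p x y :=
  exists a, a ∈ p /\ exists b, b ∈ p /\ (d_pair a x x /\ d_pair b x y /\ d_pair p a b).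
Definition d_app f x y := exists p, p ∈ f /\ d_opair p x y.

Definition d_inductive i :=
  (exists o, o ∈ i /\ d_empty o) /\
  (forall n, n ∈ i -> exists s, s ∈ i /\ d_succ s n).

(** [forall z, frame w P M v z] says that [w] is ω, [P] is the power set of [w],
    [M] is the power set of [P], and [v] is the set of even numbers. *)
Definition frame w P M v z :=
  (d_inductive w /\ (d_inductive z -> d_sub w z)) /\
  (z ∈ P <-> d_sub z w) /\ (z ∈ M <-> d_sub z P) /\
  d_sub v w /\ (forall o, o ∈ w -> d_empty o -> o ∈ v) /\
  (forall n, n ∈ w -> forall s, s ∈ w -> d_succ s n -> (s ∈ v <-> ~ n ∈ v)).

Section Frame.
Variables (w P M v : D).

Definition same S T :=
  exists m, m ∈ w /\ forall k, k ∈ w -> k ∈ m \/ (k ∈ S <-> k ∈ T).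
Definition opp S T :=
  exists m, m ∈ w /\ forall k, k ∈ w -> k ∈ m \/ (k ∈ S <-> ~ k ∈ T).

(** Among the members of [c], [g] is closed under finite modifications and
    contains exactly one of any two sets that are complementary up to a
    finite set. *)
Definition halves g c :=
  forall S, S ∈ c -> forall T, T ∈ c ->
    (same S T -> (S ∈ g <-> T ∈ g)) /\ (opp S T -> (S ∈ g <-> ~ T ∈ g)).
Definition is_class c :=
  exists e, e ∈ P /\ forall S, S ∈ P -> (S ∈ c <-> same S e \/ opp S e).

(** In the following, [A n m] says that the [n]-th move is [m]. *)
Variable A : D -> D -> Prop.

(** Nonemptiness; the trivial conjunct gives it the literal shape of a bounded existential. *)
Definition d_pos n := exists u, u ∈ n /\ u = u.
Definition d_legal n :=
  exists b, b ∈ w /\ A n b /\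
    forall m, m ∈ n -> d_pos m -> exists a, a ∈ b /\ A m a.
Definition d_taken k n :=
  (exists b, b ∈ M /\ A n b /\ k ∈ b) /\
  (forall m, m ∈ n -> d_pos m -> ~ exists b, b ∈ M /\ A m b /\ k ∈ b).
(** Move 0 is [f] itself, so a first illegal move at an odd index is due to II. *)
Definition d_interval f :=
  (exists n, n ∈ w /\ d_pos n /\ ~ n ∈ v /\ ~ d_legal n /\
     forall m, m ∈ n -> d_pos m -> d_legal m) \/
  ((forall n, n ∈ w -> d_pos n -> d_legal n) /\
   exists S, S ∈ f /\
     forall k, k ∈ w -> (k ∈ S <-> exists n, n ∈ v /\ d_pos n /\ d_taken k n)).
Definition d_won :=
  exists o, o ∈ w /\ d_empty o /\
  exists f, f ∈ M /\ A o f /\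
    (is_class f /\
       (forall i, i ∈ w -> d_pair i o o -> forall g, g ∈ M -> A i g -> ~ halves g f) \/
     halves f P /\ d_interval f).
End Frame.

Definition d_play w M x :=
  (forall p, p ∈ x -> exists n, n ∈ w /\ exists m, m ∈ M /\ d_opair p n m) /\
  (forall n, n ∈ w -> exists m, m ∈ M /\ d_app x n m /\
     forall m', m' ∈ M -> d_app x n m' -> m' = m).

Definition wins w P M v x := d_play w M x /\ d_won w P M v (d_app x).

End Winning.

(** Since the frame is unique, the winning condition holds in some frame iff it
    holds in every frame; this yields the Σ2 and the Π2 definition. *)
Lemma sigma_matrix : exists p,
  [/\ Delta0 p, free_below 6 p &
    forall (D : Type) (E : D -> D -> Prop) z v M P w x rho,
      sat E (scons z (scons v (scons M (scons P (scons w (scons x rho)))))) p <->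
      (frame E w P M v z /\ wins E w P M v x)].
Proof. by eexists; split; [ | | intros; reify]; [repeat constructor | ]. Qed.

Lemma pi_matrix : exists p,
  [/\ Delta0 p, free_below 6 p &
    forall (D : Type) (E : D -> D -> Prop) z v M P w x rho,
      sat E (scons z (scons v (scons M (scons P (scons w (scons x rho)))))) p <->
      (frame E w P M v z -> wins E w P M v x)].
Proof. by eexists; split; [ | | intros; reify]; [repeat constructor | ]. Qed.

(** The double power set of ω is singled out as the third component of the unique frame. *)
Lemma mu_formula : exists2 mu, free_below 1 mu &
  forall (D : Type) (E : D -> D -> Prop) M rho,
    sat E (scons M rho) mu <-> exists w P v, forall z, frame E w P M v z.
Proof. by eexists; [ | intros; reify]. Qed.

(** * Elementary set theory inside a model of ZF *)

Section Model.
Variables (D : Type) (E : D -> D -> Prop) (rho0 : nat -> D).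
Hypothesis model : forall p, ZF p -> forall rho, sat E rho p.

Declare Scope model_scope.
Local Open Scope model_scope.
Notation "x ∈ y" := (E x y) : model_scope.
Notation "x ∉ y" := (~ E x y) (at level 30, no associativity) : model_scope.
Implicit Types (a b c d f g m n p q s x y z : D).

Lemma ext x y : (forall z, z ∈ x <-> z ∈ y) -> x = y.
Proof. exact: (model ZF_ext rho0). Qed.

(** Definability with parameters, which the assignment [rho] carries. *)
Definition definable (P : D -> Prop) : Prop :=
  exists (rho : nat -> D) (p : form), forall x, sat E (scons x rho) p <-> P x.

(** Assignment and formula stay open while [reify] enters the parameters it meets; [rho0] then fills
    the tail of the assignment. *)
Ltac defn := unshelve (do 2 eexists; intro; reify); try exact rho0.

Lemma sep (P : D -> Prop) a :
  definable P -> exists b, forall x, x ∈ b <-> x ∈ a /\ P x.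
Proof.
case=> rho [p H]; have [k cl] : exists k, free_below k (ax_sep p).
  by exists (free_bound (ax_sep p)); apply: free_boundP.
have [b Hb] := sat_iter_all (model (ZF_sep cl)) rho a.
(* Within [ax_sep] the parameters lie behind the bound sets [b] and [a], hence the offset. *)
exists b => x; rewrite -H; set r := (fun i => if i is j.+1 then j + 3 else 0).
have <- : sat E (scons x (scons b (scons a rho))) (ren r p) <-> sat E (scons x rho) p.
  by rewrite sat_ren; apply: sat_ext => -[|i] //=; rewrite addn3.
exact: (Hb x).
Qed.

(** Turns existence in the model into an operation on [D]; the value is arbitrary when no set has
    these members, so each use comes with an existence lemma. *)
Definition set_of (P : D -> Prop) : D :=
  epsilon (inhabits (rho0 0)) (fun p => forall z, z ∈ p <-> P z).

Section SetOf.
Variables (P : D -> Prop).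
Hypothesis exP : exists p, forall z, z ∈ p <-> P z.

Lemma in_set_of z : z ∈ set_of P <-> P z.
Proof.
exact: (epsilon_spec (inhabits (rho0 0)) (fun p => forall z, z ∈ p <-> P z) exP).
Qed.

Lemma eq_set_of p : p = set_of P <-> forall z, z ∈ p <-> P z.
Proof.
split=> [-> z|H]; first exact: in_set_of.
by apply: ext => z; rewrite H in_set_of.
Qed.
End SetOf.

Lemma set_of_sub (P : D -> Prop) a :
  definable P -> (forall z, P z -> z ∈ a) -> exists p, forall z, z ∈ p <-> P z.
Proof.
move=> /(@sep _ a)[b bE] H; exists b => z; rewrite bE.
by split=> [[]|Pz] //; split=> //; apply: H.
Qed.

Definition zero := set_of (fun=> False).
Lemma ex_zero : exists p, forall z, z ∈ p <-> False.
Proof. by apply: (@set_of_sub _ (rho0 0)) => //; defn. Qed.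
Definition in_zero z : z ∈ zero <-> False :=
  in_set_of ex_zero z.
Definition zeroE p : p = zero <-> forall z, z ∈ p <-> False :=
  eq_set_of ex_zero p.

Definition upair x y := set_of (fun z => z = x \/ z = y).
Lemma ex_upair x y : exists p, forall z, z ∈ p <-> z = x \/ z = y.
Proof. exact: (model ZF_pair rho0 x y). Qed.
Definition in_upair x y z : z ∈ upair x y <-> z = x \/ z = y :=
  in_set_of (ex_upair x y) z.
Definition upairE x y p : p = upair x y <-> forall z, z ∈ p <-> z = x \/ z = y :=
  eq_set_of (ex_upair x y) p.

Definition union a := set_of (fun z => exists y, y ∈ a /\ z ∈ y).
Lemma ex_union a : exists p, forall z, z ∈ p <-> exists y, y ∈ a /\ z ∈ y.
Proof. exact: (model ZF_union rho0 a). Qed.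
Definition in_union a z : z ∈ union a <-> exists y, y ∈ a /\ z ∈ y :=
  in_set_of (ex_union a) z.

Definition sub x y := forall z, z ∈ x -> z ∈ y.

Definition pow a := set_of (fun z => sub z a).
Lemma ex_pow a : exists p, forall z, z ∈ p <-> sub z a.
Proof. exact: (model ZF_power rho0 a). Qed.
Definition in_pow a z : z ∈ pow a <-> sub z a :=
  in_set_of (ex_pow a) z.
Definition powE a p : p = pow a <-> forall z, z ∈ p <-> sub z a :=
  eq_set_of (ex_pow a) p.

Definition cup a b := set_of (fun z => z ∈ a \/ z ∈ b).
Lemma ex_cup a b : exists p, forall z, z ∈ p <-> z ∈ a \/ z ∈ b.
Proof.
apply: (@set_of_sub _ (union (upair a b))) => [|z H]; first by defn.
by apply/in_union; case: H; [exists a | exists b]; rewrite in_upair; auto.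
Qed.
Definition in_cup a b z : z ∈ cup a b <-> z ∈ a \/ z ∈ b :=
  in_set_of (ex_cup a b) z.

Definition succ a := set_of (fun z => z ∈ a \/ z = a).
Lemma ex_succ a : exists p, forall z, z ∈ p <-> z ∈ a \/ z = a.
Proof.
apply: (@set_of_sub _ (cup a (upair a a))) => [|z H]; first by defn.
by apply/in_cup; rewrite in_upair; case: H; auto.
Qed.
Definition in_succ a z : z ∈ succ a <-> z ∈ a \/ z = a :=
  in_set_of (ex_succ a) z.
Definition succE a p : p = succ a <-> forall z, z ∈ p <-> z ∈ a \/ z = a :=
  eq_set_of (ex_succ a) p.

Definition opair x y := upair (upair x x) (upair x y).

Lemma opairE x y p :
  p = opair x y <-> exists a b, a = upair x x /\ b = upair x y /\ p = upair a b.
Proof.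
split=> [->|[a [b [-> [-> ->]]]]] //.
by exists (upair x x), (upair x y).
Qed.

Tactic Notation "reify_via" uconstr(H) := refine (iff_trans _ (iff_sym H)).

Ltac reify_def y ::=
  lazymatch y with
  | zero => reify_via (zeroE _)
  | upair _ _ => reify_via (upairE _ _ _)
  | opair _ _ => reify_via (opairE _ _ _)
  | succ _ => reify_via (succE _ _)
  | pow _ => reify_via (powE _ _)
  end.

Lemma upair_inj a b c d : upair a b = upair c d -> a = c /\ b = d \/ a = d /\ b = c.
Proof.
move=> e; have H z : z = a \/ z = b <-> z = c \/ z = d by rewrite -!in_upair e.
have := (H a).1 (or_introl erefl); have := (H b).1 (or_intror erefl).
have := (H c).2 (or_introl erefl); have := (H d).2 (or_intror erefl).
by move=> [?|?] [?|?] [?|?] [?|?]; subst; auto.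
Qed.

Lemma opair_inj a b c d : opair a b = opair c d -> a = c /\ b = d.
Proof.
by case/upair_inj=> -[/upair_inj[] [? ?] /upair_inj[] [? ?]]; subst.
Qed.

Lemma zero_or_ex x : x = zero \/ exists y, y ∈ x.
Proof.
have [|N] := classic (exists y, y ∈ x); [by right | left].
by apply/zeroE => z; split=> // zx; apply: N; exists z.
Qed.

Lemma notin0 x : x ∉ zero.
Proof. by move/in_zero. Qed.

(** The foundation axiom applied to the subset of [a] cut out by [P]. *)
Lemma foundation (P : D -> Prop) a : definable P ->
  (exists2 x, x ∈ a & P x) ->
  exists x, [/\ x ∈ a, P x & forall y, y ∈ x -> y ∈ a -> ~ P y].
Proof.
move=> /(@sep _ a)[b bE] [x xa Px].
have [|y [/bE[ya Py] N]] := model ZF_found rho0 b.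
  by exists x; apply/bE.
by exists y; split=> // z zy za Pz; apply: N; exists z; split=> //; apply/bE.
Qed.

Lemma mem_irrefl x : x ∉ x.
Proof.
move=> xx; have [| |y [_ -> /(_ x)]] := @foundation (fun y => y = x) x.
- by defn.
- by exists x.
- by move/(_ xx xx); apply.
Qed.

(** * Natural numbers of the model *)

Definition inductive a :=
  (exists e, ~ (exists u, u ∈ e) /\ e ∈ a) /\
  (forall x, x ∈ a -> exists s, (forall z, z ∈ s <-> z ∈ x \/ z = x) /\ s ∈ a).

(** [inductive] copies the shape of [fInductive] so that [reify] can match the two; this is the form
    used in proofs. *)
Lemma inductiveE a :
  inductive a <-> zero ∈ a /\ forall x, x ∈ a -> succ x ∈ a.
Proof.
split=> [[[e [e0 ea] H]]|[za H]].
  split=> [|x /H[s [/succE <- //]]].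
  by case: (zero_or_ex e) e0 => [<- //|? []].
split=> [|x /H xa]; first by exists zero; split=> // -[u /notin0].
by exists (succ x); split=> // z; rewrite in_succ.
Qed.

Definition om := set_of (fun z => forall i, inductive i -> z ∈ i).
Lemma ex_om : exists p, forall z, z ∈ p <-> forall i, inductive i -> z ∈ i.
Proof.
have [i Hi] := model ZF_inf rho0.
by apply: (@set_of_sub _ i) => [|z]; [defn | apply].
Qed.
Definition in_om z : z ∈ om <-> forall i, inductive i -> z ∈ i :=
  in_set_of ex_om z.

Lemma om_inductive : inductive om.
Proof.
apply/inductiveE; split=> [|x /in_om xo]; apply/in_om => i Hi.
  by case/inductiveE: Hi.
by have /inductiveE[_] := Hi; apply; apply: xo.
Qed.

Lemma zero_om : zero ∈ om.
Proof. by have /inductiveE[] := om_inductive. Qed.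

Lemma succ_om n : n ∈ om -> succ n ∈ om.
Proof. by have /inductiveE[_] := om_inductive; apply. Qed.

Lemma omE w : w = om <-> inductive w /\ forall i, inductive i -> sub w i.
Proof.
split=> [->|[Hw Hi]].
  by split=> [|i Hi z /in_om]; [apply: om_inductive | apply].
apply: ext => z; split=> [zw|/in_om]; last exact.
by apply/in_om => i /Hi; apply.
Qed.

Lemma om_ind (P : D -> Prop) : definable P ->
  P zero -> (forall n, n ∈ om -> P n -> P (succ n)) -> forall n, n ∈ om -> P n.
Proof.
move=> /(@sep _ om)[b bE] P0 PS n /in_om no.
suff /no/bE[] : inductive b by [].
apply/inductiveE; split; first by apply/bE; split=> //; apply: zero_om.
by move=> x /bE[xo Px]; apply/bE; split; [apply: succ_om | apply: PS].
Qed.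

Lemma om_least (P : D -> Prop) n : definable P -> n ∈ om -> P n ->
  exists m, [/\ m ∈ om, P m & forall k, k ∈ m -> k ∈ om -> ~ P k].
Proof. by move=> dP no Pn; apply: foundation => //; exists n. Qed.

Lemma om_case n : n ∈ om -> n = zero \/ exists2 m, m ∈ om & n = succ m.
Proof.
suff : n ∈ om -> n = zero \/ exists m, m ∈ om /\ n = succ m.
  by move=> H /H[|[m []]]; [left | right; exists m].
move: n; refine (om_ind _ _ _) => [||n no _]; [by defn | by left | ].
by right; exists n.
Qed.

Lemma succ_refl n : n ∈ succ n.
Proof. by apply/in_succ; right. Qed.

Lemma mem_succ m n : m ∈ n -> m ∈ succ n.
Proof. by move=> mn; apply/in_succ; left. Qed.

Lemma om_trans m n : n ∈ om -> m ∈ n -> m ∈ om.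
Proof.
move=> no; move: n no m; refine (om_ind _ _ _).
- by defn.
- by move=> m /notin0.
- by move=> n no IH m /in_succ[/IH|->].
Qed.

Lemma nat_trans m n k : n ∈ om -> m ∈ n -> k ∈ m -> k ∈ n.
Proof.
move=> no mn km; move: n no m mn k km; refine (om_ind _ _ _).
- by defn.
- by move=> m /notin0.
- move=> n no IH m /in_succ[mn|->] k km; apply/in_succ; left => //.
  exact: IH mn _ km.
Qed.

Lemma zero_mem n : n ∈ om -> n = zero \/ zero ∈ n.
Proof.
move: n; refine (om_ind _ _ _) => [||n no [->|H]]; first by defn.
- by left.
- by right; apply: succ_refl.
- by right; apply: mem_succ.
Qed.

Lemma succ_mem m n : n ∈ om -> m ∈ n -> succ m ∈ succ n.
Proof.
move=> no; move: n no m; refine (om_ind _ _ _) => [|m /notin0 //|n no IH m]; first by defn.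
case/in_succ=> [/IH|->]; last exact: succ_refl.
exact: mem_succ.
Qed.

Lemma nat_total m n : m ∈ om -> n ∈ om -> [\/ m ∈ n, m = n | n ∈ m].
Proof.
move=> mo; suff : forall n, n ∈ om -> m ∈ n \/ m = n \/ n ∈ m.
  by move=> H /H[|[]]; [constructor 1 | constructor 2 | constructor 3].
refine (om_ind _ _ _) => [||k ko [H|[->|H]]]; first by defn.
- by case: (zero_mem mo) => [->|]; auto.
- by left; apply: mem_succ.
- by left; apply: succ_refl.
- by have /in_succ[] := succ_mem mo H; auto.
Qed.

Lemma nat_asym m n : n ∈ om -> m ∈ n -> n ∉ m.
Proof. by move=> no mn nm; apply: (@mem_irrefl n); apply: nat_trans nm. Qed.

Lemma succ_inj m n : m ∈ om -> succ m = succ n -> m = n.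
Proof.
move=> mo e; have := succ_refl m; have := succ_refl n.
rewrite -{1}e {2}e => /in_succ[nm|->//] /in_succ[mn|//].
by case: (nat_asym mo nm).
Qed.

(** * Products, functions and restrictions *)

Definition prod a b :=
  set_of (fun z => exists x y, x ∈ a /\ y ∈ b /\ z = opair x y).
Lemma ex_prod a b :
  exists p, forall z, z ∈ p <-> exists x y, x ∈ a /\ y ∈ b /\ z = opair x y.
Proof.
apply: (@set_of_sub _ (pow (pow (cup a b)))) => [|z]; first by defn.
case=> x [y [xa [yb ->]]]; apply/in_pow => u /in_upair H.
by apply/in_pow => v; case: H => ->; rewrite in_upair => -[] ->; apply/in_cup; auto.
Qed.
Definition in_prod a b z : z ∈ prod a b <-> exists x y, x ∈ a /\ y ∈ b /\ z = opair x y :=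
  in_set_of (ex_prod a b) z.

(** The union of all values at [x]: a total and definable operation that returns the value wherever
    there is exactly one. *)
Definition ap f x := set_of (fun z => exists y, opair x y ∈ f /\ z ∈ y).
Lemma ex_ap f x :
  exists p, forall z, z ∈ p <-> exists y, opair x y ∈ f /\ z ∈ y.
Proof.
apply: (@set_of_sub _ (union (union (union f)))) => [|z [y [xyf zy]]]; first by defn.
apply/in_union; exists y; split=> //; apply/in_union; exists (upair x y).
split; last by apply/in_upair; right.
by apply/in_union; exists (opair x y); split=> //; apply/in_upair; right.
Qed.
Definition apE f x p : p = ap f x <-> forall z, z ∈ p <-> exists y, opair x y ∈ f /\ z ∈ y :=
  eq_set_of (ex_ap f x) p.

Definition isfun f a b :=
  (forall z, z ∈ f -> exists x y, x ∈ a /\ y ∈ b /\ z = opair x y) /\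
  (forall x, x ∈ a -> exists y, forall z, opair x z ∈ f <-> z = y).

Definition res f a := set_of (fun z => z ∈ f /\ exists x y, x ∈ a /\ z = opair x y).
Lemma ex_res f a :
  exists p, forall z, z ∈ p <-> z ∈ f /\ exists x y, x ∈ a /\ z = opair x y.
Proof. by apply: (@set_of_sub _ f) => [|z []] //; defn. Qed.
Definition in_res f a z : z ∈ res f a <-> z ∈ f /\ exists x y, x ∈ a /\ z = opair x y :=
  in_set_of (ex_res f a) z.
Definition resE f a p : p = res f a <->
    forall z, z ∈ p <-> z ∈ f /\ exists x y, x ∈ a /\ z = opair x y :=
  eq_set_of (ex_res f a) p.

Ltac reify_def y ::=
  lazymatch y with
  | zero => reify_via (zeroE _)
  | upair _ _ => reify_via (upairE _ _ _)
  | opair _ _ => reify_via (opairE _ _ _)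
  | succ _ => reify_via (succE _ _)
  | pow _ => reify_via (powE _ _)
  | om => reify_via (omE _)
  | ap _ _ => reify_via (apE _ _ _)
  | res _ _ => reify_via (resE _ _ _)
  end.

Section Functions.
Variables (f a b : D).
Hypothesis Hf : isfun f a b.

Lemma mem_fun x z : x ∈ a -> opair x z ∈ f <-> z = ap f x.
Proof.
move=> /Hf.2[y Hy]; rewrite Hy; suff -> : ap f x = y by [].
apply/esym/apE => u; split=> [uy|[v [/Hy ->]] //].
by exists y; split=> //; apply/Hy.
Qed.

Lemma ap_fun x : x ∈ a -> ap f x ∈ b.
Proof.
move=> xa; have /(mem_fun _ xa)/Hf.1[u [v [_ [vb]]]] : ap f x = ap f x by [].
by case/opair_inj=> _ ->.
Qed.

Lemma mem_funE x z : opair x z ∈ f <-> x ∈ a /\ z = ap f x.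
Proof.
split=> [H|[xa /(mem_fun _ xa)]//]; suff xa : x ∈ a by split=> //; apply/mem_fun.
by have [u [v [ua [_ /opair_inj[->]]]]] := Hf.1 _ H.
Qed.

Lemma res_fun c : sub c a -> isfun (res f c) c b.
Proof.
move=> ca; split=> [z /in_res[/Hf.1[x [y [_ [yb ->]]]] [u [v [uc /opair_inj[-> _]]]]]|x xc].
  by exists u, y.
exists (ap f x) => z; rewrite in_res mem_fun; last exact: ca.
by split=> [[]|->] //; split=> //; exists x, (ap f x).
Qed.

End Functions.

Lemma fun_ext f g a b c : isfun f a b -> isfun g a c ->
  (forall x, x ∈ a -> ap f x = ap g x) -> f = g.
Proof.
move=> Hf Hg e; apply: ext => z; split=> H.
  have [x [y [xa [_ ez]]]] := Hf.1 _ H; rewrite ez in H *.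
  by move/(mem_funE Hf): H => [_ ->]; apply/(mem_funE Hg); rewrite e.
have [x [y [xa [_ ez]]]] := Hg.1 _ H; rewrite ez in H *.
by move/(mem_funE Hg): H => [_ ->]; apply/(mem_funE Hf); rewrite e.
Qed.

Lemma ap_res f a b c x : isfun f a b -> sub c a -> x ∈ c -> ap (res f c) x = ap f x.
Proof.
move=> Hf ca xc; have Hr := res_fun Hf ca.
have /in_res[H _] := (mem_fun Hr _ xc).2 erefl.
by apply/(mem_fun Hf) => //; apply: ca.
Qed.

Lemma make_fun (R : D -> D -> Prop) a b :
  definable (fun z => exists x y, z = opair x y /\ R x y) ->
  (forall x, x ∈ a -> exists2 y, y ∈ b & R x y) ->
  (forall x y z, x ∈ a -> R x y -> R x z -> y = z) ->
  exists f, isfun f a b /\ forall x, x ∈ a -> R x (ap f x).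
Proof.
move=> /(@sep _ (prod a b))[f fE] tot uniq.
have memf x y : x ∈ a -> opair x y ∈ f <-> R x y.
  move=> xa; rewrite fE in_prod; split=> [[_ [u [v [/opair_inj[-> ->]]]]] //|Rxy].
  split; last by exists x, y.
  by have [z zb /(uniq _ _ _ xa Rxy) e] := tot _ xa; exists x, y; rewrite e.
have Hf : isfun f a b.
  split=> [z /fE[/in_prod] //|x xa]; have [y yb Rxy] := tot _ xa.
  by exists y => z; rewrite memf //; split=> [/(uniq _ _ _ xa Rxy)|->].
by exists f; split=> // x xa; apply/memf => //; apply/(mem_fun Hf).
Qed.

(** * Parity *)

Definition parity_upto e n :=
  (exists o, ~ (exists u, u ∈ o) /\ o ∈ e) /\
  (forall k, k ∈ n ->
    exists s, (forall z, z ∈ s <-> z ∈ k \/ z = k) /\ (s ∈ e <-> k ∉ e)).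

Lemma parity_uptoE e n :
  parity_upto e n <-> zero ∈ e /\ forall k, k ∈ n -> (succ k ∈ e <-> k ∉ e).
Proof.
split=> [[[o [o0 oe] H]]|[ze H]].
  split=> [|k /H[s [/succE <- //]]].
  by case: (zero_or_ex o) o0 => [<- //|? []].
split=> [|k /H kn]; first by exists zero; split=> // -[u /notin0].
by exists (succ k); split=> // z; rewrite in_succ.
Qed.

Definition even n := n ∈ om /\ exists e, parity_upto e n /\ n ∈ e.

Definition evens := set_of even.
Lemma ex_evens : exists p, forall z, z ∈ p <-> even z.
Proof. by apply: (@set_of_sub _ om) => [|z []] //; defn. Qed.
Definition in_evens z : z ∈ evens <-> even z :=
  in_set_of ex_evens z.

Lemma even_zero : even zero.
Proof.
split; first exact: zero_om.
exists (upair zero zero); split; last by apply/in_upair; left.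
by apply/parity_uptoE; split=> [|k /notin0] //; apply/in_upair; left.
Qed.

Lemma parity_uniq n e e' : n ∈ om -> parity_upto e n -> parity_upto e' n ->
  n ∈ e <-> n ∈ e'.
Proof.
move=> no /parity_uptoE[e0 eS] /parity_uptoE[e0' eS'].
suff H k : k ∈ om -> k ∈ succ n -> (k ∈ e <-> k ∈ e').
  by apply: H => //; apply: succ_refl.
move: k; refine (om_ind _ _ _) => [|//|k ko IH Skn]; first by defn.
have kn : k ∈ n.
  case/in_succ: Skn => [|<-]; last exact: succ_refl.
  by move=> Skn; apply: nat_trans Skn (succ_refl k).
by rewrite eS // eS' // IH //; apply: mem_succ.
Qed.

Lemma parity_ex n : n ∈ om -> exists e, parity_upto e n.
Proof.
move: n; refine (om_ind _ _ _) => [||n no [e He]]; first by defn.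
  by have [_ [e [He _]]] := even_zero; exists e.
(* The set [e] is cut off above [n], since it may be wrong at [succ n]; then [succ n] is put in
   exactly if [n] is out. *)
have [||d dE] := @set_of_sub
  (fun z => z ∈ e /\ z ∈ succ n \/ z = succ n /\ n ∉ e) (cup e (succ (succ n))).
- by defn.
- by move=> z [[ze _]|[-> _]]; apply/in_cup; [left | right; apply: succ_refl].
have {He}/parity_uptoE[e0 eS] := He.
have ltd k : k ∈ succ n -> k ∈ d <-> k ∈ e.
  move=> kn; rewrite dE; split=> [[[]//|[eq _]]|]; last by left.
  by rewrite eq in kn; case: (@mem_irrefl _ kn).
exists d; apply/parity_uptoE; split.
  apply/ltd => //; case: (zero_mem (succ_om no)) => // e1.
  by case: (@notin0 n); rewrite -e1; apply: succ_refl.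
move=> k /in_succ[kn|->].
  rewrite ltd; last exact: succ_mem.
  by rewrite ltd ?eS //; apply: mem_succ.
rewrite (ltd n) ?dE; last exact: succ_refl.
split=> [[[_ /mem_irrefl]|[]]|] //; by right.
Qed.

Lemma even_succ n : n ∈ om -> even (succ n) <-> ~ even n.
Proof.
move=> no; have [e He] := parity_ex (succ_om no).
have Hn : parity_upto e n.
  by case/parity_uptoE: He => e0 eS; apply/parity_uptoE; split=> // k /mem_succ/eS.
have evE m : m ∈ om -> parity_upto e m -> even m <-> m ∈ e.
  move=> mo Hm; split=> [[_ [e' [He' /(parity_uniq mo Hm He')]]]|me] //.
  by split=> //; exists e.
rewrite !evE //; last exact: succ_om.
by case/parity_uptoE: He => _; apply; apply: succ_refl.
Qed.

Lemma sub_om n : n ∈ om -> sub n om.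
Proof. by move=> no k; apply: om_trans. Qed.

Lemma sub_nat m n : n ∈ om -> m ∈ n -> sub m n.
Proof. by move=> no mn k; apply: nat_trans. Qed.

Lemma succ_mem_inv m n : n ∈ om -> succ m ∈ succ n -> m ∈ n.
Proof.
move=> no /in_succ[|<-]; last exact: succ_refl.
by move=> mn; apply: nat_trans mn (succ_refl m).
Qed.

Lemma res_res f a b : sub b a -> res (res f a) b = res f b.
Proof.
move=> ba; apply: ext => z; rewrite !in_res; split=> [[[zf _] H]|[zf H]] //.
by split=> //; split=> //; have [x [y [/ba xa e]]] := H; exists x, y.
Qed.

(** * Recursion on the natural numbers *)

Section Recursion.
Variables (M : D) (H : D -> D -> D -> Prop).

(** Course-of-values recursion: [H k s v] reads as [v] being the value at [k] after the history
    [s]. *)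
Definition approx n s := isfun s n M /\ forall k, k ∈ n -> H k (res s k) (ap s k).

Hypothesis def_approx : definable (fun n => exists s, approx n s).
Hypothesis def_value : definable
  (fun z => exists n v, z = opair n v /\ exists s, approx n s /\ H n s v).
Hypothesis H_total :
  forall n s, n ∈ om -> isfun s n M -> exists2 v, v ∈ M & H n s v.
Hypothesis H_fun : forall n s v w, n ∈ om -> H n s v -> H n s w -> v = w.

(** At the least index of disagreement both histories coincide, and [H] has a single value there. *)
Lemma approx_uniq n s s' : n ∈ om -> approx n s -> approx n s' -> s = s'.
Proof.
move=> no [Hs rs] [Hs' rs']; apply: (fun_ext Hs Hs') => x xn; apply: NNPP => N.
have [||k [ko [kn Nk] min]] :=
  @om_least (fun k => k ∈ n /\ ap s k <> ap s' k) x _ (sub_om no xn).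
- by defn.
- by [].
have kn' := sub_nat no kn; apply: Nk; apply: (H_fun ko (rs _ kn)).
suff -> : res s k = res s' k by apply: rs'.
apply: (fun_ext (res_fun Hs kn') (res_fun Hs' kn')) => j jk.
rewrite (ap_res Hs kn' jk) (ap_res Hs' kn' jk); apply: NNPP => Nj.
by apply: (min j jk); [apply: (sub_om ko) | split=> //; apply: kn'].
Qed.

Lemma approx_res n s k : n ∈ om -> approx n s -> k ∈ n -> approx k (res s k).
Proof.
move=> no [Hs rs] kn; have kn' := sub_nat no kn; split; first exact: (res_fun Hs kn').
have ko := sub_om no kn => j jk.
by rewrite (ap_res Hs kn' jk) res_res; [apply/rs/kn' | apply: sub_nat].
Qed.

Lemma approx_ex n : n ∈ om -> exists s, approx n s.
Proof.
move: n; refine (om_ind _ _ _) => [||n no [s [Hs rs]]]; first exact: def_approx.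
  by exists zero; split=> [|x /notin0 //]; split=> x /notin0.
have [v vM Hv] := H_total no Hs.
have [|||f [Hf Rf]] := @make_fun
  (fun x y => x ∈ n /\ y = ap s x \/ x = n /\ y = v) (succ n) M.
- by defn.
- move=> x /in_succ[xn|->]; last by exists v; auto.
  by exists (ap s x); [apply: ap_fun Hs _ _ | auto].
- move=> x y z _ [[xn ->]|[xn ->]] [[xn' ->]|[xn' ->]] //.
    by case: (@mem_irrefl n); rewrite -{1}xn'.
  by case: (@mem_irrefl n); rewrite -{1}xn.
have nn : sub n (succ n) by move=> k; apply: mem_succ.
have fE x : x ∈ n -> ap f x = ap s x.
  move=> xn; have [[_ //]|[e _]] := Rf _ (nn _ xn).
  by case: (@mem_irrefl n); rewrite -{1}e.
have fnE : ap f n = v.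
  by have [[/mem_irrefl]|[]] := Rf _ (succ_refl n).
have rE k : sub k n -> res f k = res s k.
  move=> kn; apply: (fun_ext (res_fun Hf _) (res_fun Hs kn)) => [|x xk].
    by move=> x /kn/nn.
  by rewrite (ap_res Hf) ?(ap_res Hs) ?fE //; [apply: kn | move=> y /kn/nn].
exists f; split=> // k /in_succ[kn|->].
  by rewrite fE // rE; [apply: rs | apply: sub_nat].
rewrite fnE rE //; suff -> : res s n = s by [].
by apply: (fun_ext (res_fun Hs _) Hs) => // x xn; rewrite (ap_res Hs).
Qed.

(** The graph collects the values that follow the approximations; it is separated from [prod om M].
    Uniqueness makes approximations of different lengths cohere. *)
Lemma recursion :
  exists f, isfun f om M /\ forall n, n ∈ om -> H n (res f n) (ap f n).
Proof.
have [|||f [Hf Rf]] := @make_fun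
  (fun n v => exists s, approx n s /\ H n s v) om M.
- exact: def_value.
- move=> n no; have [s As] := approx_ex no.
  by have [v vM Hv] := H_total no As.1; exists v => //; exists s.
- move=> n v w no [s [As Hv]] [s' [As' Hw]].
  by rewrite (approx_uniq no As' As) in Hw; apply: H_fun Hv Hw.
exists f; split=> // n no; have [s [As Hv]] := Rf _ no.
suff -> : res f n = s by [].
apply: (fun_ext (res_fun Hf (sub_om no)) As.1) => k kn.
have ko := sub_om no kn; rewrite (ap_res Hf (sub_om no) kn).
have [s' [As' Hk]] := Rf _ ko; apply: (H_fun ko Hk).
by rewrite -(approx_uniq ko (approx_res no As kn) As'); apply: As.2.
Qed.

End Recursion.

(** * Copying a strategy *)

Section Copy.
(** [T] is the set of turns of the strategy [t], and [q] prescribes the moves up to the opponent's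
    turn [p], at which the additional number is played. *)
Variables M T t p q d : D.
Hypothesis T_om : sub T om.
Hypothesis T_alt : forall n, n ∈ om -> (succ n ∈ T <-> n ∉ T).
Hypothesis strat : forall n s, n ∈ T -> isfun s n M -> ap t s ∈ M.
Hypothesis p_om : p ∈ om.
Hypothesis pT : p ∉ T.
Hypothesis Hq : isfun q d M.
Hypothesis pd : sub (succ p) d.
Hypothesis q_follows : forall n, n ∈ p -> n ∈ T -> ap q n = ap t (res q n).

(** On [a], the sequence [g] is [f] with its entry at [p] deleted. *)
Definition omits g f a :=
  forall k, k ∈ a -> (k ∈ p /\ ap g k = ap f k) \/ (k ∉ p /\ ap g k = ap f (succ k)).

Lemma omits_ex f a b : isfun f b M -> (forall k, k ∈ a -> k ∈ b /\ succ k ∈ b) ->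
  exists g, isfun g a M /\ omits g f a.
Proof.
move=> Hf ab; apply: (@make_fun
  (fun k v => k ∈ p /\ v = ap f k \/ k ∉ p /\ v = ap f (succ k))).
- by defn.
- move=> k /ab[kb Skb]; have [kp|kp] := classic (k ∈ p).
    by exists (ap f k); [apply: ap_fun Hf _ kb | left].
  by exists (ap f (succ k)); [apply: ap_fun Hf _ Skb | right].
- by move=> k v w _ [[? ->]|[? ->]] [[? ->]|[? ->]].
Qed.

Lemma omits_uniq g g' f a :
  isfun g a M -> isfun g' a M -> omits g f a -> omits g' f a -> g = g'.
Proof.
move=> Hg Hg' og og'; apply: (fun_ext Hg Hg') => k ka.
by case: (og _ ka) (og' _ ka) => -[? ->] [] [? ->].
Qed.

(** The play [x] with the additional number, computed from its own history. After [p], an opponent's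
    move at [succ m] is what [t] replies to the first [m] moves of the other game, and these can be
    read off [s] by deleting entry [p]. *)
Definition next n s v :=
  n ∈ succ p /\ v = ap q n \/
  n ∉ succ p /\ (n ∈ T /\ v = ap t s \/
    n ∉ T /\ exists m s', n = succ m /\ isfun s' m M /\ omits s' s m /\ v = ap t s').

Lemma next_total n s : n ∈ om -> isfun s n M -> exists2 v, v ∈ M & next n s v.
Proof.
move=> no Hs; have [np|np] := classic (n ∈ succ p).
  by exists (ap q n); [apply: ap_fun Hq _ _; apply: pd | left].
have [nT|nT] := classic (n ∈ T).
  by exists (ap t s); [apply: strat Hs | right; auto].
have [n0|[m mo e]] := om_case no.
  case: np; rewrite n0; have [->|zp] := zero_mem p_om; first exact: succ_refl.
  exact: mem_succ.
have [|s' [Hs' os']] := @omits_ex s m n Hs.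
  by move=> k km; rewrite e; split; [apply: mem_succ | apply: succ_mem].
exists (ap t s'); last by right; split=> //; right; split=> //; exists m, s'.
(* Turns alternate and [succ m] is the opponent's, so [m] is a turn of the strategy. *)
by apply: strat Hs'; apply: NNPP => /(T_alt mo); rewrite -e.
Qed.

Lemma next_fun n s v w : n ∈ om -> next n s v -> next n s w -> v = w.
Proof.
move=> no [[np ->]|[np Hv]] [[np' ->]|[np' Hw]] //.
case: Hv Hw => [[nT ->]|[nT [m [s1 [e [H1 [o1 ->]]]]]]] [[nT' ->]|[nT' Hw]] //.
have [m' [s2 [e' [H2 [o2 ->]]]]] := Hw.
have mo : m ∈ om by apply: (om_trans no); rewrite e; apply: succ_refl.
have em : m' = m by apply/esym/succ_inj => //; rewrite -e.
by rewrite em in H2 o2; rewrite (omits_uniq H1 H2 o1 o2).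
Qed.

Definition follows x := forall n, n ∈ T -> ap x n = ap t (res x n).

(** [x] comes from recursion along [next], and [y] is [x] without entry [p]. From [p] on, a turn [n]
    of the strategy in [y] is the opponent's turn [succ n] in [x], where the reply in [y] was
    copied. *)
Lemma copy : exists x y,
  [/\ isfun x om M, isfun y om M, follows x & follows y] /\
  [/\ forall n, n ∈ succ p -> ap x n = ap q n,
      forall n, n ∈ p -> ap y n = ap x n &
      forall n, n ∈ om -> n ∉ p -> ap y n = ap x (succ n)].
Proof.
have [||||x [Hx Rx]] := @recursion M next;
  [by defn | by defn | exact: next_total | exact: next_fun | ].
have xq n : n ∈ succ p -> ap x n = ap q n.
  by move=> np; have [[_]|[]] := Rx _ (om_trans (succ_om p_om) np).
have [|y [Hy oy]] := @omits_ex x om om Hx; first by move=> k ko; split=> //; apply: succ_om.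
have pp : sub p om by apply: sub_om.
have fx : follows x.
  move=> n nT; have no := T_om nT.
  have [[np ->]|[_ [[_ //]|[//]]]] := Rx _ no.
  (* The index [p] itself is the opponent's, so the prescribed moves due to [t] lie strictly before
     it. *)
  have {}np : n ∈ p by case/in_succ: np nT => // ->.
  rewrite q_follows //; congr (ap t _).
  have nd : sub n d by move=> k kn; apply/pd/mem_succ/(sub_nat p_om np).
  apply: (fun_ext (res_fun Hq nd) (res_fun Hx (sub_om no))) => k kn.
  rewrite (ap_res Hq nd kn) (ap_res Hx (sub_om no) kn) xq //.
  exact/mem_succ/(sub_nat p_om np).
have y1 n : n ∈ p -> ap y n = ap x n.
  by move=> np; have [[_ ->]|[]] := oy n (pp _ np).
have y2 n : n ∈ om -> n ∉ p -> ap y n = ap x (succ n).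
  by move=> no np; have [[]|[_ ->]] := oy n no.
exists x, y; split; split=> // n nT; have no := T_om nT.
have [np|np] := classic (n ∈ p).
  rewrite y1 // fx //; congr (ap t _).
  apply: (fun_ext (res_fun Hx (sub_om no)) (res_fun Hy (sub_om no))) => k kn.
  rewrite (ap_res Hx (sub_om no) kn) (ap_res Hy (sub_om no) kn) y1 //.
  exact: sub_nat kn.
have Sno := succ_om no; rewrite y2 //.
have [[/(succ_mem_inv p_om)//]|[_ [[/(T_alt no)//]|]]] := Rx _ Sno.
move=> [_ [m [s [/(succ_inj no) <- [Hs [os ->]]]]]]; congr (ap t _).
apply: (fun_ext Hs (res_fun Hy (sub_om no))) => k kn.
have ko := sub_om no kn.
rewrite (ap_res Hy (sub_om no) kn).
have [[kp ->]|[kp ->]] := os _ kn.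
  by rewrite y1 // (ap_res Hx (sub_om Sno)) //; apply: mem_succ.
by rewrite y2 // (ap_res Hx (sub_om Sno)) //; apply: succ_mem.
Qed.

End Copy.
(** * The interval game *)

Definition legal x n :=
  ap x n ∈ om /\ forall m, m ∈ n -> m <> zero -> ap x m ∈ ap x n.

Definition taken x k n :=
  k ∈ ap x n /\ forall m, m ∈ n -> m <> zero -> k ∉ ap x m.

Definition first_illegal x n :=
  n <> zero /\ ~ legal x n /\ forall m, m ∈ n -> m <> zero -> legal x m.

Definition all_legal x := forall n, n ∈ om -> n <> zero -> legal x n.

Definition territory x S :=
  forall k, k ∈ om -> (k ∈ S <-> exists n, n ∈ evens /\ n <> zero /\ taken x k n).

Definition interval x f :=
  (exists n, n ∈ om /\ n ∉ evens /\ first_illegal x n) \/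
  (all_legal x /\ exists S, S ∈ f /\ territory x S).

Section Taken.
Variable x : D.
Hypothesis Lx : all_legal x.

Lemma move_om n : n ∈ om -> n <> zero -> ap x n ∈ om.
Proof. by move=> no n0; have [] := Lx no n0. Qed.

Lemma succ_neq0 n : succ n <> zero.
Proof. by move=> e; apply: (@notin0 n); rewrite -e; apply: succ_refl. Qed.

Lemma moves_grow k : k ∈ om -> k ∈ ap x (succ (succ k)).
Proof.
move=> ko; have Lk n : n ∈ om -> ap x (succ n) ∈ ap x (succ (succ n)).
  move=> no; have [_] := Lx (succ_om (succ_om no)) (@succ_neq0 _).
  by apply; [apply: succ_refl | apply: succ_neq0].
suff : k ∈ ap x (succ k) \/ k = ap x (succ k).
  case=> [H|{1}->]; last exact: Lk.
  apply: nat_trans (Lk _ ko) H.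
  by apply: move_om; [do 2 apply: succ_om | apply: succ_neq0].
move: k ko; refine (om_ind _ _ _) => [||n no IH]; first by defn.
  have := zero_mem (move_om (succ_om zero_om) (@succ_neq0 _)).
  by case=> [->|]; auto.
have ao := move_om (succ_om no) (@succ_neq0 n).
have bo := move_om (succ_om (succ_om no)) (@succ_neq0 (succ n)).
have ab := Lk _ no.
case: (nat_total (succ_om no) bo) => [H|H|bn]; [by left | by right | ].
have an : ap x (succ n) ∈ n.
  by case/in_succ: bn => [bn|bn]; [apply: (nat_trans no bn) | move: ab; rewrite bn].
case: IH => [na|e]; first by case: (nat_asym no an).
by case: (@mem_irrefl n); rewrite {1}e.
Qed.

Lemma taken_ex k : k ∈ om -> exists n, [/\ n ∈ om, n <> zero & taken x k n].
Proof.
move=> ko; have [||n [no [n0 kn] min]] :=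
  @om_least (fun n => n <> zero /\ k ∈ ap x n) _ _ (succ_om (succ_om ko)).
- by defn.
- by split; [apply: succ_neq0 | apply: moves_grow].
exists n; split=> //; split=> // m mn m0 km.
by apply: (min m mn) => //; apply: (sub_om no).
Qed.

Lemma taken_uniq k m n : m ∈ om -> m <> zero -> n ∈ om -> n <> zero ->
  taken x k m -> taken x k n -> m = n.
Proof.
move=> mo m0 no n0 [km Hm] [kn Hn].
by case: (nat_total mo no) => // [/Hn|/Hm] []; auto.
Qed.

Lemma territory_ex : exists2 S, sub S om & territory x S.
Proof.
have [|S HS] := @sep (fun k => exists n, n ∈ evens /\ n <> zero /\ taken x k n) om.
  by defn.
exists S => [k /HS[] //|k ko]; rewrite HS.
by split=> [[]|].
Qed.

End Taken.

Lemma evens_om : sub evens om.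
Proof. by move=> n /in_evens[]. Qed.

Lemma evens_alt n : n ∈ om -> (succ n ∈ evens <-> n ∉ evens).
Proof. by move=> no; rewrite !in_evens; apply: even_succ. Qed.

Lemma territory_unique x S T : sub S om -> sub T om ->
  territory x S -> territory x T -> S = T.
Proof.
move=> So To HS HT; apply: ext => k.
by split=> H; [have ko := So _ H; apply/HT => //; apply/HS
              |have ko := To _ H; apply/HS => //; apply/HT].
Qed.

Section Clash.
(** [T] holds the turns of the strategy's owner and [y] omits the additional number at [p]. The
    instances are [p] = 1 against player I and [p] = 2 against player II, so before [p] there are
    only the opening and the owner's moves. *)
Variables T p x y : D.
Hypothesis T_om : sub T om.
Hypothesis T_alt : forall n, n ∈ om -> (succ n ∈ T <-> n ∉ T).
Hypothesis p_om : p ∈ om.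
Hypothesis p0 : p <> zero.
Hypothesis pT : p ∉ T.
Hypothesis below_p : forall n, n ∈ p -> n <> zero -> n ∈ T.
Hypothesis y1 : forall n, n ∈ p -> ap y n = ap x n.
Hypothesis y2 : forall n, n ∈ om -> n ∉ p -> ap y n = ap x (succ n).
Hypothesis legal_p : (forall m, m ∈ p -> m <> zero -> legal x m) -> legal x p.
Hypothesis okx : forall n, n ∈ T -> ~ first_illegal x n.
Hypothesis oky : forall n, n ∈ T -> ~ first_illegal y n.

(** Deleting an entry keeps the order of the others, so legality passes to [y] from the index the
    move had in [x]. *)
Lemma legal_omit k : k ∈ om -> k <> zero ->
  (k ∈ p -> legal x k) -> (k ∉ p -> legal x (succ k)) -> legal y k.
Proof.
move=> ko k0 H1 H2; have [kp|kp] := classic (k ∈ p).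
  have [ak Hk] := H1 kp; rewrite /legal y1 //; split=> // j jk j0.
  by rewrite y1; [apply: Hk | apply: (nat_trans p_om kp)].
have [ak Hk] := H2 kp; rewrite /legal y2 //; split=> // j jk j0.
have [jp|jp] := classic (j ∈ p); first by rewrite y1 //; apply/Hk/j0/mem_succ.
rewrite y2 //; last exact: (sub_om ko).
by apply: Hk; [apply: succ_mem | apply: succ_neq0].
Qed.

(** The first illegal move of [x] would be a move of the opponent after [p], hence a copy of the
    owner's move in [y]. That one is legal in [y], which forces legality in [x] as well. *)
Lemma legal_all : all_legal x.
Proof.
move=> n no n0; apply: NNPP => Nn.
have [||{Nn n0}m [mo [m0 Nm] min]] :=
  @om_least (fun n => n <> zero /\ ~ legal x n) n _ no; [by defn | by [] | ].
have {min} Lm k : k ∈ m -> k <> zero -> legal x k.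
  move=> km k0; apply: NNPP => Nk; apply: (min k km) => //.
  exact: (sub_om mo).
have mT : m ∉ T by move=> mT; case: (okx mT).
have mp : m <> p by move=> e; rewrite e in Nm Lm; apply: Nm; apply: legal_p.
have pm : p ∈ m.
  by case: (nat_total p_om mo) => [//|e|/below_p/(_ m0)//]; case: mp.
have [//|[j jo e]] := om_case mo.
have jT : j ∈ T by apply: NNPP => /(T_alt jo); rewrite -e.
have pj : p ∈ j by move: pm; rewrite e => /in_succ[//|e']; case: pT; rewrite e'.
have j0 : j <> zero by move=> e0; move: pj; rewrite e0 => /notin0.
have jp : j ∉ p by apply: nat_asym.
have jm : j ∈ m by rewrite e; apply: succ_refl.
have [aj Hj] : legal y j.
  apply: NNPP => Nj; apply: (oky jT); split=> //; split=> // k kj k0.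
  have km := sub_nat mo jm kj; apply: legal_omit => // [|_|_].
  - exact: (sub_om jo).
  - exact: Lm.
  - by apply: Lm; [rewrite e; apply: succ_mem | apply: succ_neq0].
rewrite y2 // -e in aj Hj.
(* A move of [x] strictly between [p] and [m] is an earlier move of [y] than [j], and [ap y j] is
   [ap x m]. *)
have after k : k ∈ m -> p ∈ k -> ap x k ∈ ap x m.
  move=> km pk; have ko := sub_om mo km.
  have [k0|[i io ei]] := om_case ko; first by rewrite k0 in pk; case: (notin0 pk).
  have ij : i ∈ j by apply: succ_mem_inv; rewrite // -ei -e.
  have ip : i ∉ p.
    by move=> ip; rewrite ei in pk; case/in_succ: pk => [/(nat_asym p_om ip) //|/esym e' //];
       apply: (@mem_irrefl p); rewrite -{1}e'.
  rewrite ei -(y2 io ip); apply: Hj => // i0.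
  by rewrite ei i0 in pk; case/in_succ: pk => // /notin0.
apply: Nm; split=> // k km k0.
have [kp|kp] := classic (k ∈ p).
  by rewrite -y1 //; apply: Hj => //; apply: nat_trans pj kp.
have ko := sub_om mo km.
case: (nat_total p_om ko) => [pk|<-|//]; first exact: after.
(* The move at [p] is invisible in [y]; it is compared with [ap x m] through the move at [j], which
   lies after [p]. *)
have [aj' Hj'] := Lm _ jm j0.
exact: nat_trans aj (after _ jm pj) (Hj' _ pj p0).
Qed.

Lemma legal_all_omit : all_legal y.
Proof.
move=> n no n0; apply: legal_omit => // _; apply: legal_all => //.
  exact: succ_om.
exact: succ_neq0.
Qed.

(** A number not below the additional one is taken only after it, and by a move that occurs in [y]
    one index earlier. *)
Lemma taken_omit k n : n ∈ om -> n <> zero -> taken x k n -> k ∉ ap x p ->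
  exists m, [/\ m ∈ om, m <> zero, n = succ m & taken y k m].
Proof.
move=> no n0 [kn min] kp.
have pn : p ∈ n.
  case: (nat_total p_om no) => [//|e|np]; first by rewrite e in kp.
  case: kp; have [ap_om Hp] := legal_all p_om p0.
  exact: nat_trans ap_om (Hp _ np n0) kn.
have [//|[m mo e]] := om_case no; have mp : m ∉ p.
  move=> mp; rewrite e in pn; case/in_succ: pn => [/(nat_asym p_om mp) //|e'].
  by apply: (@mem_irrefl p); rewrite {1}e'.
exists m; split=> // [m0|].
  by rewrite e m0 in pn; case/in_succ: pn => // /notin0.
split=> [|j jm j0]; first by rewrite y2 // -e.
have [jp|jp] := classic (j ∈ p).
  by rewrite y1 //; apply: min => //; rewrite e; apply: mem_succ.
rewrite y2 //; last exact: (sub_om mo).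
by apply: min; [rewrite e; apply: succ_mem | apply: succ_neq0].
Qed.

(** Past the omitted move the two players have exchanged their roles. *)
Lemma territory_opp S S' : territory x S -> territory y S' -> opp E om S S'.
Proof.
(* The exchange of territories can fail only below the additional number, hence at finitely many
   places. *)
move=> HS HS'; exists (ap x p); split; first by case: (legal_all p_om p0).
move=> k ko; have [?|kp] := classic (k ∈ ap x p); [by left | right].
rewrite HS // HS' //.
have [n [no n0 tn]] := taken_ex legal_all ko.
have [m [mo m0 e tm]] := taken_omit no n0 tn kp.
have -> : (exists n, n ∈ evens /\ n <> zero /\ taken x k n) <-> n ∈ evens.
  split=> [[i [iv [i0 ti]]]|]; last by exists n.
  by rewrite (taken_uniq no n0 (evens_om iv) i0 tn ti).
have -> : (exists n, n ∈ evens /\ n <> zero /\ taken y k n) <-> m ∈ evens.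
  split=> [[i [iv [i0 ti]]]|]; last by exists m.
  by rewrite (taken_uniq mo m0 (evens_om iv) i0 tm ti).
by rewrite e; apply: evens_alt.
Qed.

(** Both plays are legal throughout, so each is decided by its territory; the territories are almost
    complementary, and [f] contains exactly one of them. *)
Lemma interval_clash f : f ∈ pow (pow om) -> halves E om f (pow om) ->
  interval x f <-> ~ interval y f.
Proof.
move=> fM hf; have [S So HS] := territory_ex x; have [S' So' HS'] := territory_ex y.
have intE z U : all_legal z -> sub U om -> territory z U -> interval z f <-> U ∈ f.
  move=> Lz Uo HU; split=> [[[n [no [_ [n0 [N _]]]]]|[_ [V [Vf HV]]]]|Uf].
  - by case: N; apply: Lz.
  - suff -> : U = V by [].
    by apply: territory_unique HU HV => //; apply/in_pow; move/in_pow: fM; apply.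
  - by right; split=> //; exists U.
rewrite (intE x S legal_all) // (intE y S' legal_all_omit) //.
have [_] := hf S (proj2 (in_pow om S) So) S' (proj2 (in_pow om S') So').
by apply; apply: territory_opp.
Qed.

End Clash.

(** * No player has a winning strategy *)

Local Notation P_ := (pow om).
Local Notation M_ := (pow (pow om)).
Local Notation same := (same E om).
Local Notation opp := (opp E om).
Local Notation halves := (halves E om).
Local Notation is_class := (is_class E om P_).
Local Notation one := (succ zero).
Local Notation two := (succ (succ zero)).

(** * Almost equal and almost complementary sets *)

Lemma om_max m n : m ∈ om -> n ∈ om -> exists k, [/\ k ∈ om, sub m k & sub n k].
Proof.
move=> mo no; case: (nat_total mo no) => [mn|<-|nm]; [exists n|exists m|exists m].
- by split=> //; apply: sub_nat.
- by split.
- by split=> //; apply: sub_nat.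
Qed.

Lemma same_refl S : same S S.
Proof. by exists zero; split; [apply: zero_om | right]. Qed.

Lemma same_sym S T : same S T -> same T S.
Proof.
case=> m [mo H]; exists m; split=> // k ko.
by case: (H k ko) => [|->]; [left | right].
Qed.

Lemma opp_sym S T : opp S T -> opp T S.
Proof.
case=> m [mo H]; exists m; split=> // k ko.
case: (H k ko) => [|e]; [by left | right].
by split=> [kT /e //|kS]; apply: NNPP => /e.
Qed.

Lemma same_trans S T U : same S T -> same T U -> same S U.
Proof.
move=> [m [mo Hm]] [n [no Hn]]; have [k [ko mk nk]] := om_max mo no.
exists k; split=> // i io; have := Hm i io; have := Hn i io.
by case=> [/nk|<-]; [left | case=> [/mk|<-]; [left | right]].
Qed.

Lemma same_opp S T U : same S T -> opp T U -> opp S U.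
Proof.
move=> [m [mo Hm]] [n [no Hn]]; have [k [ko mk nk]] := om_max mo no.
exists k; split=> // i io; have := Hm i io; have := Hn i io.
by case=> [/nk|<-]; [left | case=> [/mk|<-]; [left | right]].
Qed.

Lemma opp_opp S T U : opp S T -> opp T U -> same S U.
Proof.
move=> [m [mo Hm]] /opp_sym[n [no Hn]]; have [k [ko mk nk]] := om_max mo no.
exists k; split=> // i io; have := Hm i io; have := Hn i io.
by case=> [/nk|->]; [left | case=> [/mk|->]; [left | right]].
Qed.

(** A number beyond both finite exceptional parts would contradict itself. *)
Lemma same_opp_absurd S T : same S T -> ~ opp S T.
Proof.
move=> [m [mo Hm]] [n [no Hn]]; have [k [ko mk nk]] := om_max mo no.
have := Hm k ko; have := Hn k ko.
by case=> [/nk/mem_irrefl //|e]; case=> [/mk/mem_irrefl //|e']; tauto.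
Qed.

Lemma opp_ex S : S ∈ P_ -> exists2 T, T ∈ P_ & opp S T.
Proof.
move=> SP; have [|T HT] := @sep (fun k => k ∉ S) om; first by defn.
exists T; first by apply/in_pow => k /HT[].
exists zero; split=> [|k ko]; [exact: zero_om | right; rewrite HT].
by split=> [kS [_ //]|N]; apply: NNPP => kS; apply: N.
Qed.

(** A class contains a set together with its complement. Hence no opening is of both kinds. *)
Lemma class_not_halves c : is_class c -> ~ halves c P_.
Proof.
move=> [e [eP ce]] H; have [T TP eT] := opp_ex eP.
have /proj1 := (H e eP T TP).2 eT; rewrite !ce //; apply.
  by left; apply: same_refl.
by right; apply: opp_sym.
Qed.

Lemma class_halves e c : e ∈ P_ ->
  (forall S, S ∈ P_ -> (S ∈ c <-> same S e \/ opp S e)) -> sub c P_ ->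
  exists2 g, g ∈ M_ & halves g c.
Proof.
move=> eP ce cP; have [|g gE] := @sep (fun S => same S e) P_; first by defn.
exists g => [|S Sc T Tc]; first by apply/in_pow => S /gE[].
have [SP TP] := (cP _ Sc, cP _ Tc); rewrite !gE; split=> [ST|ST].
  by split=> -[_ H]; split=> //; [apply: same_trans H; apply: same_sym | apply: same_trans H].
split=> [[_ Se] [_ Te]|N].
  by apply: (same_opp_absurd (same_trans Se (same_sym Te))).
split=> //; case: (proj1 (ce T TP) Tc) => [Te|Te]; last exact: opp_opp ST Te.
by case: N.
Qed.

Lemma one_mem n : n ∈ one -> n = zero.
Proof. by case/in_succ => // /notin0. Qed.

Lemma two_mem n : n ∈ two -> n <> zero -> n = one.
Proof. by case/in_succ => // /one_mem. Qed.

Lemma one_om : one ∈ om.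
Proof. exact/succ_om/zero_om. Qed.

Lemma two_om : two ∈ om.
Proof. exact/succ_om/one_om. Qed.

Lemma zero_one : zero ∈ one.
Proof. exact: succ_refl. Qed.

Lemma zero_evens : zero ∈ evens.
Proof. exact/in_evens/even_zero. Qed.

Lemma one_evens : one ∉ evens.
Proof. by move=> H; apply: (proj1 (evens_alt zero_om) H); apply: zero_evens. Qed.

Lemma two_evens : two ∈ evens.
Proof. exact: (proj2 (evens_alt one_om) one_evens). Qed.

Lemma pow_pow_om n : n ∈ om -> n ∈ M_.
Proof.
move=> no; apply/in_pow => k kn; apply/in_pow.
exact: (sub_om (sub_om no kn)).
Qed.

Lemma three_values a b c : a ∈ M_ -> b ∈ M_ -> c ∈ M_ ->
  exists q, [/\ isfun q (succ two) M_, ap q zero = a, ap q one = b & ap q two = c].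
Proof.
move=> aM bM cM.
have n01 : zero <> one by move=> e; apply: (@notin0 zero); rewrite {2}e; apply: zero_one.
have n12 : one <> two by move=> /(succ_inj zero_om).
have n02 : zero <> two by move=> /esym/succ_neq0.
have [|||q [Hq Rq]] := @make_fun (fun k v =>
    k = zero /\ v = a \/ k = one /\ v = b \/ k = two /\ v = c) (succ two) M_.
- by defn.
- move=> k /in_succ[/in_succ[/one_mem|]|] ->; [exists a|exists b|exists c]; auto 6.
- move=> k v w _ [[-> ->]|[[-> ->]|[-> ->]]] [[e ->]|[[e ->]|[e ->]]] //;
  by first [ case: (n01 e) | case: (n02 e) | case: (n12 e)
           | case: (n01 (esym e)) | case: (n02 (esym e)) | case: (n12 (esym e)) ].
exists q; split=> //.
- have [|[_ //]|[[/n01 //]|[/n02 //]]] := Rq zero.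
  by do 2 apply: mem_succ; apply: zero_one.
- have [|[/esym/n01 //]|[[_ //]|[/n12 //]]] := Rq one.
  by apply: mem_succ; apply: succ_refl.
- have [|[/esym/n02 //]|[[/esym/n12 //]|[_ //]]] := Rq two.
  exact: succ_refl.
Qed.

(** * Defeating a strategy of player I *)

Definition won x :=
  is_class (ap x zero) /\ ~ halves (ap x one) (ap x zero) \/
  halves (ap x zero) P_ /\ interval x (ap x zero).

Lemma first_illegal_uniq x m n : m ∈ om -> n ∈ om ->
  first_illegal x m -> first_illegal x n -> m = n.
Proof.
move=> mo no [m0 [Nm Lm]] [n0 [Nn Ln]].
by case: (nat_total mo no) => // [/Ln/(_ m0)|/Lm/(_ n0)].
Qed.

Lemma no_winning_I t :
  (forall n s, n ∈ evens -> isfun s n M_ -> ap t s ∈ M_) ->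
  ~ (forall x, isfun x om M_ -> follows evens t x -> won x).
Proof.
move=> strat win; set f := ap t zero.
have fM : f ∈ M_.
  apply: (strat zero); first exact: zero_evens.
  by split=> [|x /notin0 //]; move=> x /notin0.
have plays g : g ∈ M_ -> exists x y,
    [/\ isfun x om M_, isfun y om M_, won x & won y] /\
    [/\ ap x zero = f, ap x one = g, ap y zero = f &
        forall n, n ∈ om -> n ∉ one -> ap y n = ap x (succ n)].
  move=> gM; have [q [Hq q0 q1 _]] := three_values fM gM gM.
  have [||x [y [[Hx Hy fx fy] [xq y1 y2]]]] :=
    @copy M_ evens t one q _ evens_om evens_alt strat one_om one_evens Hq.
  - by move=> k; apply: mem_succ.
  - move=> n /one_mem -> _; rewrite q0; congr (ap t _).
    by apply/esym/zeroE => z; rewrite in_res; split=> // -[_ [u [v [/notin0]]]].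
  exists x, y; have x0 : ap x zero = f by rewrite xq //; apply/mem_succ/zero_one.
  split; split=> //; try by apply: win.
    by rewrite xq //; apply: succ_refl.
  by rewrite y1 //; apply: zero_one.
have [cf|Ncf] := classic (is_class f).
  have [e [eP ce]] := cf.
  have [|g gM hg] := class_halves eP ce; first by move=> S; move/in_pow: fM; apply.
  have [x [y [[_ _ wx _] [x0 x1 _ _]]]] := plays g gM.
  move: wx; rewrite /won x0 x1 => -[[_ N]|[H _]]; first exact: N.
  exact: class_not_halves cf H.
(* The additional number is 0 at index 1; being the first number played, it is legal. *)
have [x [y [[Hx Hy wx wy] [x0 x1 y0 y2]]]] := plays zero (pow_pow_om zero_om).
move: wx wy; rewrite /won x0 y0 => -[[]//|[hf ix]] [[]//|[_ iy]].
(* A play has at most one first illegal move, and in a play won by I it can only be at an odd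
   index. *)
have even_ok z : interval z f -> forall n, n ∈ evens -> ~ first_illegal z n.
  move=> iz n nE fn; have no := evens_om nE.
  case: iz => [[m [mo [mE fm]]]|[Lz _]].
    by apply: mE; rewrite (first_illegal_uniq mo no fm fn).
  by case: fn => n0 [[]]; apply: Lz.
have below n : n ∈ one -> n <> zero -> n ∈ evens by move/one_mem.
have same_below n : n ∈ one -> ap y n = ap x n by move=> /one_mem ->; rewrite x0.
have legal_one : (forall m, m ∈ one -> m <> zero -> legal x m) -> legal x one.
  by move=> _; rewrite /legal x1; split=> [|m /one_mem]; [apply: zero_om | ].
have [/(_ ix)] := interval_clash evens_alt one_om (@succ_neq0 _) one_evens below
  same_below y2 legal_one (even_ok x ix) (even_ok y iy) fM hf.
by [].
Qed.

(** * Defeating a strategy of player II *)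

Definition odds := set_of (fun n => n ∈ om /\ n ∉ evens).
Lemma ex_odds : exists p, forall z, z ∈ p <-> z ∈ om /\ z ∉ evens.
Proof. by apply: (@set_of_sub _ om) => [|z []] //; defn. Qed.
Definition in_odds z : z ∈ odds <-> z ∈ om /\ z ∉ evens := in_set_of ex_odds z.

Lemma odds_om : sub odds om.
Proof. by move=> n /in_odds[]. Qed.

Lemma odds_alt n : n ∈ om -> (succ n ∈ odds <-> n ∉ odds).
Proof.
move=> no; have Sno := succ_om no; rewrite !in_odds evens_alt //.
by split=> [[_ N] [_ //]|N]; split=> // nE; apply: N.
Qed.

Lemma single_fun c : c ∈ M_ -> isfun (upair (opair zero c) (opair zero c)) one M_.
Proof.
move=> cM; split=> [z /in_upair H|x /one_mem ->].
  by exists zero, c; split; [apply: zero_one | split=> //; case: H].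
by exists c => z; rewrite in_upair; split=> [[] /opair_inj[]|->] //; left.
Qed.

Lemma no_winning_II t :
  (forall n s, n ∈ odds -> isfun s n M_ -> ap t s ∈ M_) ->
  ~ (forall x, isfun x om M_ -> follows odds t x -> ~ won x).
Proof.
(* The reply to the opening [c]: the argument of [t] is the sequence of length one with entry
   [c]. *)
move=> strat win; pose R c := ap t (upair (opair zero c) (opair zero c)).
have one_odds : one ∈ odds by apply/in_odds; split; [apply: one_om | apply: one_evens].
have two_odds : two ∉ odds by case/in_odds=> _; apply; apply: two_evens.
have RM c : c ∈ M_ -> R c ∈ M_ by move=> cM; apply: (strat one) => //; apply: single_fun.
have plays c b : c ∈ M_ -> b ∈ M_ -> exists x y,
    [/\ isfun x om M_, isfun y om M_, ~ won x & ~ won y] /\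
    [/\ ap x zero = c, ap x one = R c, ap x two = b,
        forall n, n ∈ two -> ap y n = ap x n &
        forall n, n ∈ om -> n ∉ two -> ap y n = ap x (succ n)].
  move=> cM bM; have [q [Hq q0 q1 q2]] := three_values cM (RM _ cM) bM.
  have [||x [y [[Hx Hy fx fy] [xq y1 y2]]]] :=
    @copy M_ odds t two q _ odds_om odds_alt strat two_om two_odds Hq.
  - by [].
  - move=> n n2 nO; have -> : n = one.
      by apply: two_mem => // e; move: nO; rewrite e => /in_odds[_]; case; apply: zero_evens.
    have one3 : sub one (succ two) by move=> k /mem_succ/mem_succ.
    rewrite q1; congr (ap t _).
    apply: (fun_ext (single_fun cM) (res_fun Hq one3)) => k /one_mem ->.
    rewrite (ap_res Hq one3) ?q0; last exact: zero_one.
    by apply/esym/(mem_fun (single_fun cM)); [apply: zero_one | apply/in_upair; left].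
  exists x, y; split; split=> //; try by apply: win.
  - by rewrite xq //; do 2 apply: mem_succ; apply: zero_one.
  - by rewrite xq //; apply: mem_succ; apply: succ_refl.
  - by rewrite xq //; apply: succ_refl.
pose class_of S c := forall T, T ∈ P_ -> (T ∈ c <-> same T S \/ opp T S).
have R_halves S c : S ∈ P_ -> c ∈ M_ -> class_of S c -> halves (R c) c.
  move=> SP cM cS; have [x [y [[_ _ Nx _] [x0 x1 _ _ _]]]] := plays c c cM cM.
  apply: NNPP => N; apply: Nx; left; rewrite x0 x1; split=> //.
  by exists S.
have class_ex S : S ∈ P_ -> exists2 c, c ∈ M_ & class_of S c.
  move=> SP; have [|c cE] := @sep (fun T => same T S \/ opp T S) P_; first by defn.
  exists c => [|T TP]; first by apply/in_pow => T /cE[].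
  by rewrite cE; split=> [[]|].
(* Each [S] is judged by the strategy's reply to its own class. The class is determined by [S], so
   [F] is defined without any choice. *)
have [|F FE] := @sep (fun S => exists c, c ∈ M_ /\
    (forall T, T ∈ P_ -> (T ∈ c <-> same T S \/ opp T S)) /\
    S ∈ ap t (upair (opair zero c) (opair zero c))) P_; first by defn.
have FM : F ∈ M_ by apply/in_pow => S /FE[].
have memF S c : S ∈ P_ -> c ∈ M_ -> class_of S c -> S ∈ F <-> S ∈ R c.
  move=> SP cM cS; rewrite FE; split=> [[_ [c' [cM' [cS' Sc']]]]|Sc]; last first.
    by split=> //; exists c.
  suff <- : c' = c by [].
  apply: ext => T; split=> H.
    have TP : T ∈ P_ by move/in_pow: cM'; apply.
    by apply/cS/(cS' T TP).
  have TP : T ∈ P_ by move/in_pow: cM; apply.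
  by apply/cS'/(cS T TP).
(* Almost equal or almost complementary sets have the same class, so both are judged by one and the
   same half [R c]. *)
have hF : halves F P_.
  move=> S SP T TP; have [c cM cS] := class_ex S SP.
  have hR := R_halves S c SP cM cS.
  have Sc : S ∈ c by apply/cS => //; left; apply: same_refl.
  split=> ST.
    have Tc : T ∈ c by apply/cS => //; left; apply: same_sym.
    rewrite (memF S c) // (memF T c) //; first exact: (hR S Sc T Tc).1.
    move=> U UP; rewrite cS //; split=> -[H|H].
    - by left; apply: same_trans ST.
    - by right; apply/opp_sym/(same_opp (same_sym ST))/opp_sym.
    - by left; apply/(same_trans H)/same_sym.
    - by right; apply/opp_sym/(same_opp ST)/opp_sym.
  have Tc : T ∈ c by apply/cS => //; right; apply: opp_sym.
  rewrite (memF S c) // (memF T c) //; first exact: (hR S Sc T Tc).2.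
  move=> U UP; rewrite cS //; split=> -[H|H].
  - by right; apply: same_opp ST.
  - by left; apply: opp_opp ST.
  - by right; apply: same_opp (opp_sym ST).
  - by left; apply: opp_opp (opp_sym ST).
(* The additional number, at index 2, is one above II's first number. If [R F] is not a number, II
   has erred already and any move will do. *)
have [b [bM bE]] : exists b, b ∈ M_ /\ (R F ∈ om -> b = succ (R F)).
  have [ao|ao] := classic (R F ∈ om).
    by exists (succ (R F)); split=> //; apply/pow_pow_om/succ_om.
  by exists zero; split=> //; apply/pow_pow_om/zero_om.
have [x [y [[Hx Hy wx wy] [x0 x1 x2 y1 y2]]]] := plays F b FM bM.
have Nx : ~ interval x F by move=> i; apply: wx; right; rewrite x0.
have y0 : ap y zero = F by rewrite y1 //; apply/mem_succ/zero_one.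
have Ny : ~ interval y F by move=> i; apply: wy; right; rewrite y0.
have odd_ok z : ~ interval z F -> forall n, n ∈ odds -> ~ first_illegal z n.
  by move=> Nz n /in_odds[no nE] fn; apply: Nz; left; exists n.
have below n : n ∈ two -> n <> zero -> n ∈ odds by move=> n2 n0; rewrite (two_mem n2 n0).
have legal_two : (forall m, m ∈ two -> m <> zero -> legal x m) -> legal x two.
  move=> L1; have [] := L1 one (succ_refl _) (@succ_neq0 _); rewrite x1 => ao _.
  rewrite /legal x2 bE //; split=> [|m m2 m0]; first exact: succ_om.
  by rewrite (two_mem m2 m0) x1; apply: succ_refl.
have [_ /(_ Ny)] := interval_clash odds_alt two_om (@succ_neq0 _) two_odds below
  y1 y2 legal_two (odd_ok x Nx) (odd_ok y Ny) FM hF.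
by [].
Qed.

(** * Interpretation of the formulas *)

Lemma d_emptyE o : d_empty E o <-> o = zero.
Proof. by rewrite zeroE; split=> H u; [split=> // /H | move/H]. Qed.

Lemma d_succE s n : d_succ E s n <-> s = succ n.
Proof.
split=> [[H1 [H2 ns]]|->].
  by apply/succE => z; split=> [/H1|[/H2|->]].
by split=> [u /in_succ|] //; split=> [u|]; [apply: mem_succ | apply: succ_refl].
Qed.

Lemma d_pairE p x y : d_pair E p x y <-> p = upair x y.
Proof.
split=> [[H1 [xp yp]]|->].
  by apply/upairE => z; split=> [/H1|[->|->]].
by split=> [u /in_upair|] //; split; apply/in_upair; auto.
Qed.

Lemma d_opairE p x y : d_opair E p x y <-> p = opair x y.
Proof.
split=> [[a [ap [b [bp [/d_pairE -> [/d_pairE -> /d_pairE ->]]]]]]|->] //.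
exists (upair x x); split; first by apply/in_upair; left.
exists (upair x y); split; first by apply/in_upair; right.
by rewrite !d_pairE.
Qed.

Lemma d_appE f x y : d_app E f x y <-> opair x y ∈ f.
Proof.
split=> [[p [pf /d_opairE <-]] //|H].
by exists (opair x y); split=> //; apply/d_opairE.
Qed.

Lemma d_inductiveE a : d_inductive E a <-> inductive a.
Proof.
rewrite inductiveE; split=> [[[o [oa /d_emptyE e]] H]|[za H]].
  by rewrite e in oa; split=> // x /H[s [sa /d_succE <-]].
split; first by exists zero; split=> //; apply/d_emptyE.
by move=> x /H; exists (succ x); split=> //; apply/d_succE.
Qed.

(** The clauses in [z] are the defining properties of ω and of the two power sets; the clauses on
    [v] fix it by induction. *)
Lemma frameE w P M v :
  (forall z, frame E w P M v z) <-> [/\ w = om, P = P_, M = M_ & v = evens].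
Proof.
split=> [H|[-> -> -> ->] z].
  have ew : w = om.
    apply/omE; split; first by apply/d_inductiveE; have [[]] := H zero.
    by move=> i /d_inductiveE; have [[_]] := H i.
  have eP : P = P_ by apply/powE => z; have [_ []] := H z; rewrite ew.
  have eM : M = M_ by apply/powE => z; have [_ [_ []]] := H z; rewrite eP.
  split=> //; have [_ [_ [_ [vo [v0 vS]]]]] := H zero; rewrite ew in vo v0 vS.
  suff vE n : n ∈ om -> n ∈ v <-> n ∈ evens.
    by apply: ext => n; split=> nv; [apply/vE/nv/vo | apply/(vE _ (evens_om nv))].
  move: n; refine (om_ind _ _ _) => [||n no IH]; first by defn.
    split=> _; first exact: zero_evens.
    by apply: v0; [apply: zero_om | apply/d_emptyE].
  rewrite evens_alt // -IH; apply: vS => //; [exact: succ_om | exact/d_succE].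
split.
  split; first exact/d_inductiveE/om_inductive.
  by move=> /d_inductiveE Hi k /in_om; apply.
split; first exact: in_pow.
split; first exact: in_pow.
split; first exact: evens_om.
split=> [o _ /d_emptyE ->|n no s _ /d_succE ->]; first exact: zero_evens.
exact: evens_alt.
Qed.

Lemma d_playE M x : d_play E om M x <-> isfun x om M.
Proof.
split=> [[H1 H2]|[H1 H2]]; split.
- move=> z /H1[n [no [m [mM /d_opairE ->]]]]; exists n, m; split=> //.
- move=> n /H2[m [mM [/d_appE nm uniq]]]; exists m => z; split=> [nz|->] //.
  have [n' [_ [m' [mM' /d_opairE/opair_inj[_ e]]]]] := H1 _ nz.
  by apply: uniq; [rewrite e | apply/d_appE].
- move=> z /H1[n [m [no [mM ->]]]]; exists n; split=> //; exists m; split=> //.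
  exact/d_opairE.
- move=> n no; have [m Hm] := H2 _ no; exists m.
  have nm : opair n m ∈ x by apply/Hm.
  split; last by split=> [|m' _ /d_appE/Hm]; first exact/d_appE.
  by have [n' [m' [_ [mM /opair_inj[_ ->]]]]] := H1 _ nm.
Qed.

Section Play.
Variable x : D.
Hypothesis Hx : isfun x om M_.

Lemma d_app_fun n m : d_app E x n m <-> n ∈ om /\ m = ap x n.
Proof. by rewrite d_appE (mem_funE Hx). Qed.

Lemma d_posE n : d_pos E n <-> n <> zero.
Proof.
split=> [[u [un _]] e|]; first by move: un; rewrite e => /notin0.
by case: (zero_or_ex n) => // -[u un] _; exists u.
Qed.

Lemma d_legalE n : n ∈ om -> d_legal E om (d_app E x) n <-> legal x n.
Proof.
move=> no; split=> [[b [bo [/d_app_fun[_ eb] H]]]|[bo H]].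
  rewrite eb in bo H; split=> // m mn /d_posE m0.
  by have [a [ab /d_app_fun[_ <-]]] := H m mn m0.
exists (ap x n); split=> //; split; first exact/d_app_fun.
move=> m mn /d_posE m0; exists (ap x m); split; first exact: H.
by apply/d_app_fun; split=> //; apply: om_trans mn.
Qed.

Lemma d_takenE k n : n ∈ om -> d_taken E M_ (d_app E x) k n <-> taken x k n.
Proof.
move=> no; have inE m : m ∈ om ->
    (exists b, b ∈ M_ /\ d_app E x m b /\ k ∈ b) <-> k ∈ ap x m.
  move=> mo; split=> [[b [_ [/d_app_fun[_ ->]]]] //|km].
  exists (ap x m); split; first exact: (ap_fun Hx mo).
  by split=> //; apply/d_app_fun.
split=> -[kn H]; (split; first exact/(inE n no)) => m mn.
  by move=> m0 km; apply: (H m mn); [apply/d_posE | apply/(inE m (om_trans no mn))].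
by move=> /d_posE m0 /(inE m (om_trans no mn)); apply: H.
Qed.

Lemma d_intervalE f :
  d_interval E om M_ evens (d_app E x) f <-> interval x f.
Proof.
have belowE n : n ∈ om ->
    (forall m, m ∈ n -> d_pos E m -> d_legal E om (d_app E x) m) <->
    (forall m, m ∈ n -> m <> zero -> legal x m).
  move=> no; split=> H m mn m0; have mo := om_trans no mn.
    by apply/(d_legalE mo)/H => //; apply/d_posE.
  by apply/(d_legalE mo)/H => //; apply/d_posE.
have allE : (forall n, n ∈ om -> d_pos E n -> d_legal E om (d_app E x) n) <->
    all_legal x.
  by split=> H n no n0; apply/(d_legalE no)/H => //; apply/d_posE.
have territoryE S : (forall k, k ∈ om ->
      (k ∈ S <-> exists n, n ∈ evens /\ d_pos E n /\ d_taken E M_ (d_app E x) k n)) <->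
    territory x S.
  have exE k : (exists n, n ∈ evens /\ d_pos E n /\ d_taken E M_ (d_app E x) k n) <->
      (exists n, n ∈ evens /\ n <> zero /\ taken x k n).
    split=> -[n [nE [n0 tn]]]; exists n; split=> //; split; try exact/d_posE.
      exact/(d_takenE k (evens_om nE)).
    exact/(d_takenE k (evens_om nE)).
  by split=> H k ko; rewrite H // exE.
split=> [[[n [no [/d_posE n0 [nE [Nn H]]]]]|[H [S [Sf HS]]]]
        |[[n [no [nE [n0 [Nn H]]]]]|[H [S [Sf HS]]]]].
- left; exists n; split=> //; split=> //; split=> //; split; last exact/belowE.
  by move=> L; apply: Nn; apply/d_legalE.
- by right; split; [apply/allE | exists S; split=> //; apply/territoryE].
- left; exists n; split=> //; split; first exact/d_posE.
  split=> //; split; last exact/belowE.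
  by move=> /(d_legalE no).
- by right; split; [apply/allE | exists S; split=> //; apply/territoryE].
Qed.

Lemma d_wonE : d_won E om P_ M_ evens (d_app E x) <-> won x.
Proof.
(* In [d_won] the index 1 is described as the pair of zero with itself. *)
have oneE : one = upair zero zero.
  by apply/upairE => z; rewrite in_succ in_zero; tauto.
have zM := ap_fun Hx zero_om.
split=> [[o [_ [/d_emptyE -> [f [_ [/d_app_fun[_ ->] H]]]]]]|H].
  case: H => [[cf H]|[hf H]]; [left; split=> // | by right; split=> //; apply/d_intervalE].
  apply: (H one one_om) => //; [exact/d_pairE | exact: (ap_fun Hx one_om) | ].
  by apply/d_app_fun; split=> //; apply: one_om.
exists zero; split; first exact: zero_om.
split; first exact/d_emptyE.
exists (ap x zero); split=> //.
split; first by apply/d_app_fun; split=> //; apply: zero_om.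
case: H => [[cf H]|[hf H]]; [left; split=> // | by right; split=> //; apply/d_intervalE].
by move=> i _ /d_pairE -> g _ /d_app_fun[_ ->]; rewrite -oneE.
Qed.

End Play.

Lemma winsE x : wins E om P_ M_ evens x <-> isfun x om M_ /\ won x.
Proof.
split=> -[]; first by move=> /d_playE Hx /(d_wonE Hx).
by move=> Hx /(d_wonE Hx) w; split=> //; apply/d_playE.
Qed.

(** * Satisfaction of the formulas about plays and strategies *)

Implicit Types (rho : nat -> D) (i j k : nat).

Lemma sat_nat rho i : sat E rho (fNat i) <-> rho i ∈ om.
Proof. reify. Qed.

Lemma sat_even rho i : sat E rho (fEven i) <-> rho i ∈ evens.
Proof.
(* The conjunctions are regrouped as in [fEven], which [reify] has to match literally. *)
rewrite in_evens; have -> : even (rho i) <-> rho i ∈ om /\ exists e,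
    (exists o, ~ (exists u, u ∈ o) /\ o ∈ e) /\
    (forall x, x ∈ rho i -> exists s,
       (forall z, z ∈ s <-> z ∈ x \/ z = x) /\ (s ∈ e <-> x ∉ e)) /\ rho i ∈ e.
  split=> -[no [e]]; first by case=> -[H1 H2] H3; split=> //; exists e.
  by case=> H1 [H2 H3]; split=> //; exists e.
reify.
Qed.

Lemma sat_odd rho i : sat E rho (fOdd i) <-> rho i ∈ odds.
Proof. by rewrite in_odds -sat_even -sat_nat. Qed.

Lemma sat_play rho i j : sat E rho (fPlay i j) <-> isfun (rho i) om (rho j).
Proof.
apply: (@reify_term _ E rho _ _ om (fun w => isfun (rho i) w (rho j))) => w.
  reify.
reify.
Qed.

Definition strategy T t M := exists A,
  (forall s, s ∈ A <-> exists n, n ∈ T /\ isfun s n M) /\ isfun t A M.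

Lemma strategy_move T t M : strategy T t M ->
  forall n s, n ∈ T -> isfun s n M -> ap t s ∈ M.
Proof.
by case=> A [HA Ht] n s nT Hs; apply: (ap_fun Ht); apply/HA; exists n.
Qed.

Section Turn.
Variables (turn : nat -> form) (T : D).
Hypothesis turnP : forall rho i, sat E rho (turn i) <-> rho i ∈ T.
Hypothesis T_om : sub T om.

Lemma sat_position rho i j : sat E rho (fPosition turn i j) <->
  exists n, n ∈ T /\ isfun (rho i) n (rho j).
Proof.
apply: reify_ex => n; apply: reify_and; [exact: turnP | reify].
Qed.

Lemma sat_strategy rho i j :
  sat E rho (fStrategy turn i j) <-> strategy T (rho i) (rho j).
Proof.
apply: reify_ex => A; apply: reify_and; last reify.
by apply: reify_all => s; apply: reify_iff; [reify | apply: sat_position].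
Qed.

Lemma sat_follows rho i j : sat E rho (fFollows turn i j) <->
  forall n, n ∈ T -> exists s y,
    s = res (rho i) n /\ opair n y ∈ rho i /\ opair s y ∈ rho j.
Proof.
apply: reify_all => n; apply: reify_imp; first exact: turnP.
reify.
Qed.

(** Membership of pairs in [t] agrees with [ap t] on positions, and every restriction of a play to a
    turn is a position. *)
Lemma follows_sat rho i j k : strategy T (rho j) (rho k) ->
  isfun (rho i) om (rho k) -> follows T (rho j) (rho i) ->
  sat E rho (fFollows turn i j).
Proof.
case=> A [HA Ht] Hx fx; apply/sat_follows => n nT.
exists (res (rho i) n), (ap (rho i) n); split=> //; split.
  by apply/(mem_fun Hx); first exact: T_om.
apply/(mem_fun Ht); last exact: fx.
by apply/HA; exists n; split=> //; apply: (res_fun Hx (sub_om (T_om nT))).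
Qed.

End Turn.

Lemma undetermined (mu chi theta : form) :
  (forall M rho, sat E (scons M rho) mu <->
     exists w P v, forall z, frame E w P M v z) ->
  (forall z v M P w x rho,
     sat E (scons z (scons v (scons M (scons P (scons w (scons x rho)))))) chi <->
     (frame E w P M v z /\ wins E w P M v x)) ->
  (forall z v M P w x rho,
     sat E (scons z (scons v (scons M (scons P (scons w (scons x rho)))))) theta <->
     (frame E w P M v z -> wins E w P M v x)) ->
  sat E rho0 (∃ ∃ (fUniquely mu 1 ∧ fGame 1 0 ∧
    fExtension (∃ ∃ ∃ ∃ ∀ chi) 0 ∧ fExtension (∀ ∀ ∀ ∀ ∃ theta) 0 ∧
    ¬ ∃ (fWinningI 2 1 0) ∧ ¬ ∃ (fWinningII 2 1 0)))%fm.
Proof.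
move=> muE chiE thetaE.
have [|W WE] := @sep (fun x => isfun x om M_ /\ won x) (pow (prod om M_)).
  (* As local variables these sets become parameters of the formula, and [reify] does not expand
     them. *)
  pose P := P_; pose M := M_; pose v := evens.
  have [rho [p H]] : definable (wins E om P M v) by defn.
  by exists rho, p => x; rewrite H winsE.
have {}WE x : x ∈ W <-> isfun x om M_ /\ won x.
  rewrite WE; split=> [[]|[Hx wx]] //; split=> //; apply/in_pow => z /Hx.1.
  by move=> H; apply/in_prod.
have frame0 : forall z, frame E om P_ M_ evens z by apply/frameE.
exists M_, W; split; [|split; [|split; [|split; [|split]]]].
- move=> d; split=> [/muE[w [P [v /frameE[_ _ -> _]]]] //|/= ->].
  by apply/muE; exists om, P_, evens.
- split; first by exists zero; apply/pow_pow_om/zero_om.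
  by move=> x /WE[Hx _]; apply/sat_play.
(* The Σ2 form: the existential quantifiers can only be met by the true frame. *)
- move=> x; split=> [/WE wx|[w [P [M [v H]]]]].
    exists om, P_, M_, evens => z; apply/chiE; split; first exact: frame0.
    exact/winsE.
  have /frameE[ew eP eM ev] : forall z, frame E w P M v z.
    by move=> z; have /chiE[] := H z.
  by have /chiE[_] := H zero; rewrite ew eP eM ev => /winsE/WE.
(* The Π2 form: if the four sets are not the frame, some [z] violates a clause and makes the
   implication vacuous. *)
- move=> x; split=> [/WE wx w P M v|H].
    have [/frameE[-> -> -> ->]|/not_all_ex_not[z Nz]] := classic (forall z, frame E w P M v z).
      by exists zero; apply/thetaE => _; apply/winsE.
    by exists z; apply/thetaE.
  by have [z /thetaE/(_ (frame0 z))/winsE/WE] := H om P_ M_ evens.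
- case=> t [/(sat_strategy sat_even) Ht Hwin].
  apply: (no_winning_I (strategy_move Ht)) => x Hx fx.
  suff : x ∈ W by case/WE.
  apply: (Hwin x); split; first exact/sat_play.
  exact: (@follows_sat _ _ sat_even evens_om _ 0 1 3 Ht Hx fx).
- case=> t [/(sat_strategy sat_odd) Ht Hwin].
  apply: (no_winning_II (strategy_move Ht)) => x Hx fx wx.
  apply: (Hwin x); last exact/WE.
  split; first exact/sat_play.
  exact: (@follows_sat _ _ sat_odd odds_om _ 0 1 3 Ht Hx fx).
Qed.

End Model.

Theorem theorem4 :
  exists mu sigma pi : form,
    [/\ free_below 1 mu, free_below 1 sigma, free_below 1 pi,
        Sigma 2 sigma & Pi 2 pi] /\
    proves ZF
      (∃ ∃ (fUniquely mu 1 ∧ fGame 1 0 ∧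
            fExtension sigma 0 ∧ fExtension pi 0 ∧
            ¬ ∃ (fWinningI 2 1 0) ∧ ¬ ∃ (fWinningII 2 1 0)))%fm.
Proof.
have [chi [chi0 chi6 chiE]] := sigma_matrix.
have [theta [theta0 theta6 thetaE]] := pi_matrix.
have [mu mu1 muE] := mu_formula.
exists mu, (∃ ∃ ∃ ∃ ∀ chi)%fm, (∀ ∀ ∀ ∀ ∃ theta)%fm; split.
  split=> //.
    (* Four quantifiers of one kind range over the frame, and one of the other kind over the test
       set [z]. *)
    do 4 apply: Sigma_ex; apply/Sigma_Pi/Pi_all/Pi_Sigma.
    exact: Sigma_Delta0.
  do 4 apply: Pi_all; apply/Pi_Sigma/Sigma_ex/Sigma_Pi.
  exact: Pi_Delta0.
apply: completeness => [p /ZF_closed //||D E rho model].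
  by rewrite /= !(free_below_leq _ chi6) ?(free_below_leq _ theta6) ?(free_below_leq _ mu1).
exact: (@undetermined D E rho model mu chi theta (muE D E) (chiE D E) (thetaE D E)).
Qed.
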